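(* Let $\Omega=(0,1)$ and, for $N\in\mathbb N$ and $r\in(0,\frac12)$, let $\mathcal T_{r,N}$ be the $\frac1N$-periodic mesh of $[0,1]$ obtained by alternatingly concatenating intervals of length $\frac rN$ and $\frac{1-r}N$. Fix an admissible symmetric mean $\theta$ (i.e. $\theta(a,b)=\theta(b,a)$), and consider the transport metrics $\mathcal W_{\mathcal T_{r,N}}$ defined by setting $\theta_{KL}=\theta$ for all $K,L$. Then there exist probability measures $\mu_0,\mu_1\in\mathcal P(\overline\Omega)$ such that, for each fixed $r\in(0,\frac12)$, $$\limsup_{N\to\infty}\mathcal W_{\mathcal T_{r,N}}(P_{\mathcal T_{r,N}}\mu_0,P_{\mathcal T_{r,N}}\mu_1)<\mathbb W_2(\mu_0,\mu_1).$$
   Context: $\mathcal P(\overline\Omega)$ is the set of Borel probability measures on $\overline\Omega=[0,1]$, and $\mathbb W_2$ is the $2$-Kantorovich (Wasserstein) metric. The mesh $\mathcal T_{r,N}$ consists of the cells $[\frac kN,\frac{k+r}N)$ and $[\frac{k+r}N,\frac{k+1}N)$, $k=0,\dots,N-1$, with the point $1$ added to the last cell; the point $x_K$ associated with a cell $K$ is its midpoint. Thus adjacent cells $K\sim L$ satisfy $d_{KL}=|x_K-x_L|=\frac1{2N}$, and the interface $(K|L)=\overline K\cap\overline L$ is a single point with $|(K|L)|=1$. An admissible mean is a continuous function $\theta:\mathbb R_+\times\mathbb R_+\to\mathbb R_+$ (with $\mathbb R_+=[0,\infty)$) that is $C^\infty$ on $(0,\infty)^2$, positively $1$-homogeneous,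 jointly concave, and satisfies $\theta(1,1)=1$. For a mesh $\mathcal T$, $\mathcal P(\mathcal T)$ is the set of probability measures on the finite set $\mathcal T$. For $m\in\mathcal P(\mathcal T)$ and $\psi,\sigma:\mathcal T\to\mathbb R$, $$\mathcal A_{\mathcal T}(m,\psi)=\tfrac12\sum_{K\sim L}\tfrac{|(K|L)|}{d_{KL}}\,\theta_{KL}\Big(\tfrac{m(K)}{|K|},\tfrac{m(L)}{|L|}\Big)(\psi(K)-\psi(L))^2,\qquad \mathcal A^*_{\mathcal T}(m,\sigma)=\sup_{\psi:\mathcal T\to\mathbb R}\Big\{2\sum_K\psi(K)\sigma(K)-\mathcal A_{\mathcal T}(m,\psi)\Big\}$$ (sum over ordered pairs of adjacent cells; $|K|$ is the length of $K$), and $\mathcal W_{\mathcal T}(m_0,m_1)=\inf\big(\int_0^1\mathcal A^*_{\mathcal T}(m_t,\dot m_t)\,dt\big)^{1/2}$, the infimum over all curves $(m_t)_{t\in[0,1]}$ in $\mathcal P(\mathcal T)$ from $m_0$ to $m_1$ such that $t\mapsto m_t(K)$ is absolutely continuous for each $K$. $P_{\mathcal T}:\mathcal P(\overline\Omega)\to\mathcal P(\mathcal T)$ is given by $(P_{\mathcal T}\mu)(K)=\mu(K)$. *)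

(* Defs.v *)
From HB Require Import structures.
From mathcomp Require Import all_boot all_order all_algebra.
From mathcomp Require Import all_classical all_reals all_analysis.
Set Implicit Arguments.
Unset Strict Implicit.
Unset Printing Implicit Defensive.
Import Order.TTheory GRing.Theory Num.Theory.
Import numFieldNormedType.Exports.
Local Open Scope classical_set_scope.
Local Open Scope ring_scope.

(* On an open set D of the plane: all iterated partial derivatives of f up to
   order k exist and are continuous. *)
Fixpoint Ck_on (R : realType) (D : set (R * R)) (k : nat) (f : R * R -> R) : Prop :=
  (forall p, D p -> {for p, continuous f}) /\
  if k is k'.+1 then
    forall v : R * R, v = (1, 0) \/ v = (0, 1) ->
      (forall p, D p -> derivable f p v) /\ Ck_on D k' (fun p => 'D_v f p)
  else True.

Definition smooth_on (R : realType) (D : set (R * R)) (f : R * R -> R) : Prop :=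
  forall k, Ck_on D k f.

(* A mean is a function on the closed quadrant; its values off the quadrant
   are unconstrained and never used. *)
Record admissible_mean (R : realType) (theta : R -> R -> R) : Prop := {
  mean_ge0 : forall a b : R, 0 <= a -> 0 <= b -> 0 <= theta a b;
  mean_continuous : {within [set p : R * R | 0 <= p.1 /\ 0 <= p.2],
    continuous (fun p : R * R => theta p.1 p.2)};
  mean_smooth : smooth_on [set p : R * R | 0 < p.1 /\ 0 < p.2]
    (fun p => theta p.1 p.2);
  mean_homogeneous : forall c a b : R, 0 < c -> 0 <= a -> 0 <= b ->
    theta (c * a) (c * b) = c * theta a b;
  mean_concave : forall t a b a' b' : R, 0 <= t <= 1 ->
    0 <= a -> 0 <= b -> 0 <= a' -> 0 <= b' ->
    t * theta a b + (1 - t) * theta a' b' <=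
      theta (t * a + (1 - t) * a') (t * b + (1 - t) * b');
  mean_one : theta 1 1 = 1
}.

Definition symmetric_mean (R : realType) (theta : R -> R -> R) : Prop :=
  forall a b : R, 0 <= a -> 0 <= b -> theta a b = theta b a.

Record mesh (R : realType) := Mesh {
  cell_index :> finType;
  cell : cell_index -> set R;
  pt : cell_index -> R
}.

Section mesh_transport.
Context {R : realType} (T : mesh R).
Implicit Types (K L : T) (m sigma psi : T -> R).

Definition vol K : R := fine (lebesgue_measure (cell K)).

Definition interface K L : set R := closure (cell K) `&` closure (cell L).

Definition adjacent K L : bool := (K != L) && `[< interface K L !=set0 >].

Definition is_prob m : Prop := (forall K, 0 <= m K) /\ \sum_K m K = 1.

(* The weight |(K|L)| is 1 in dimension one: interfaces are single points. *)
Definition action (theta : T -> T -> R -> R -> R) m psi : R :=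
  2^-1 * \sum_K \sum_(L | adjacent K L)
    1 / `|pt K - pt L| * theta K L (m K / vol K) (m L / vol L) *
    (psi K - psi L) ^+ 2.

Definition dual_action (theta : T -> T -> R -> R -> R) m sigma : \bar R :=
  ereal_sup [set (2 * (\sum_K psi K * sigma K) - action theta m psi)%:E
            | psi in [set: T -> R]].

End mesh_transport.

Definition abs_continuous (R : realType) (a b : R) (f : R -> R) : Prop :=
  forall eps : R, 0 < eps -> exists2 delta : R, 0 < delta &
    forall (n : nat) (s t : 'I_n -> R),
      (forall i, a <= s i /\ s i <= t i /\ t i <= b) ->
      trivIset [set: 'I_n] (fun i => `]s i, t i[%classic) ->
      \sum_i (t i - s i) < delta ->
      \sum_i `|f (t i) - f (s i)| < eps.

Definition is_curve (R : realType) (T : mesh R) (m0 m1 : T -> R)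
    (m : R -> T -> R) : Prop :=
  [/\ forall t, 0 <= t <= 1 -> is_prob (m t),
      forall K, abs_continuous 0 1 (m ^~ K),
      m 0 = m0 & m 1 = m1].

(* Coordinates of a curve are differentiable almost everywhere on [0, 1]; the
   values of the derivative on the exceptional null set are immaterial. *)
Definition transport_metric (R : realType) (T : mesh R)
    (theta : T -> T -> R -> R -> R) (m0 m1 : T -> R) : \bar R :=
  ereal_inf [set sqrte (\int[@lebesgue_measure R]_(t in `[0%R, 1%R])
                   dual_action theta (m t) (fun K => derive1 (m ^~ K) t))%E
            | m in is_curve m0 m1].

(* Borel probability measures on [0, 1], as Borel probability measures on the
   line giving full mass to [0, 1]. *)
Definition on_unit_interval (R : realType)
    (mu : probability (measurableTypeR R) R) : Prop :=
  mu `[0%R, 1%R]%classic = 1%E.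

Definition mesh_proj (R : realType) (T : mesh R)
    (mu : probability (measurableTypeR R) R) : T -> R :=
  fun K => fine (mu (cell K)).
Arguments mesh_proj {R} T mu.

Definition coupling (R : realType) (mu nu : probability (measurableTypeR R) R)
    (g : probability (measurableTypeR R * measurableTypeR R)%type R) : Prop :=
  forall A : set (measurableTypeR R), measurable A ->
    pushforward g fst A = mu A /\ pushforward g snd A = nu A.

Definition W2 (R : realType) (mu nu : probability (measurableTypeR R) R) : \bar R :=
  ereal_inf [set sqrte (\int[g]_p (`|p.1 - p.2| ^+ 2)%:E)%E | g in coupling mu nu].

(* Cells of T_{r,N}: (k, false) is [k/N, (k+r)/N) and (k, true) is
   [(k+r)/N, (k+1)/N), closed on the right when k = N-1. *)
Section periodic_mesh.
Context {R : realType} (r : R) (N : nat).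
Implicit Type K : ('I_N * bool)%type.

Definition cell_left K : R :=
  if K.2 then (K.1%:R + r) / N%:R else K.1%:R / N%:R.

Definition cell_right K : R :=
  if K.2 then (K.1.+1)%:R / N%:R else (K.1%:R + r) / N%:R.

Definition periodic_cell K : set R :=
  if K.2 && (K.1.+1 == N) then `[cell_left K, cell_right K]%classic
  else `[cell_left K, cell_right K[%classic.

Definition periodic_mesh : mesh R :=
  {| cell := periodic_cell;
     pt := fun K => (cell_left K + cell_right K) / 2 |}.

End periodic_mesh.

(* Main.v *)
Require Import Defs.
From HB Require Import structures.
From mathcomp Require Import all_boot all_order all_algebra.
From mathcomp Require Import all_classical all_reals all_analysis.
From mathcomp Require Import measurable_realfun.
From mathcomp Require Import ring lra.
Set Implicit Arguments.
Unset Strict Implicit.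
Unset Printing Implicit Defensive.
Import Order.TTheory GRing.Theory Num.Theory.
Import numFieldNormedType.Exports.
Local Open Scope classical_set_scope.
Local Open Scope ring_scope.

(** In a period with density [rho], put the fraction [alpha] of the mass in the
    short cell instead of the fraction [r]. The two densities become
    [rho * alpha / r] and [rho * (1 - alpha) / (1 - r)], whose mean is
    [rho * Theta] with [Theta = theta (alpha / r) ((1 - alpha) / (1 - r))]. By
    symmetry and homogeneity both partial derivatives of [theta] at (1, 1) are
    1/2, so for [r < 1/2] some [alpha > r] gives [Theta > 1]: oscillating
    densities have a larger mobility, and transport along them costs less by
    the factor [Theta].

    Take for [mu_0] a tent-shaped density on [0, 1/2] and for [mu_1] its
    translate by 1/2, so that the difference of the means gives
    [W2 mu_0 mu_1 >= 1/2]. The competitor first redistributes the mass inside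
    each period, then translates the tent at constant speed with proportions
    [alpha], [1 - alpha] in every period, then redistributes back. The
    redistributions have length [tau] in time and cost [O(1 / (tau N^2))]; the
    translation costs [1 / (4 (1 - 2 tau) Theta) + O(1 / N)]. The tent is
    Lipschitz, which bounds the flux by the masses of both neighbouring
    periods, so the fronts of the travelling tent need no separate treatment. *)

(** * The tent density *)

Section tent.
Context {R : realType}.
Implicit Types x y h : R.

Definition pospart x : R := Num.max 0 x.

(** The squared positive part has derivative [2 * pospart x] and a second derivative between 0 and
    2. *)
Lemma pospart_taylor x y :
  0 <= pospart y ^+ 2 - pospart x ^+ 2 - 2 * pospart x * (y - x)
    <= (y - x) ^+ 2.
Proof.
have ? := sqr_ge0 x; have ? := sqr_ge0 y; have ? := sqr_ge0 (y - x).
rewrite /pospart; case: (leP 0 x) => hx; case: (leP 0 y) => hy;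
  [|have ? : x * y <= 0 by nra|have ? : x * y <= 0 by nra|];
  by rewrite sqrrB; apply/andP; split; lra.
Qed.

(** A second difference of the positive part: slope 16 on [0, 1/4], slope -16 on [1/4, 1/2], peak 4,
    total mass 1. *)
Definition tent x : R :=
  16 * (pospart x - 2 * pospart (x - 4^-1) + pospart (x - 2^-1)).

Definition tent_cdf x : R :=
  8 * (pospart x ^+ 2 - 2 * pospart (x - 4^-1) ^+ 2 + pospart (x - 2^-1) ^+ 2).

(** Three remainders with weights 8, -16, 8, each between 0 and the squared increment, give the
    constant 16. This estimate is the source of the later derivatives and mass bounds. *)
Lemma tent_cdf_taylor x y :
  `|tent_cdf y - tent_cdf x - tent x * (y - x)| <= 16 * (y - x) ^+ 2.
Proof.
have := pospart_taylor x y; have := pospart_taylor (x - 4^-1) (y - 4^-1).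
have := pospart_taylor (x - 2^-1) (y - 2^-1).
rewrite /tent /tent_cdf !opprB !addrA !subrK.
move=> /andP[? ?] /andP[? ?] /andP[? ?].
by rewrite ler_norml; apply/andP; split; lra.
Qed.

Lemma tent_ge0 x : 0 <= tent x.
Proof.
by rewrite /tent /pospart; case: (leP 0 x) => ?; case: (leP 0 (x - 4^-1)) => ?;
  case: (leP 0 (x - 2^-1)) => ?; lra.
Qed.

Lemma tent_le x : tent x <= 4.
Proof.
by rewrite /tent /pospart; case: (leP 0 x) => ?; case: (leP 0 (x - 4^-1)) => ?;
  case: (leP 0 (x - 2^-1)) => ?; lra.
Qed.

Lemma tentN x : x <= 0 -> tent x = 0.
Proof.
by move=> ?; rewrite /tent /pospart; case: (leP 0 x) => ?;
  case: (leP 0 (x - 4^-1)) => ?; case: (leP 0 (x - 2^-1)) => ?; lra.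
Qed.

Lemma tentP x : 2^-1 <= x -> tent x = 0.
Proof.
by move=> ?; rewrite /tent /pospart; case: (leP 0 x) => ?;
  case: (leP 0 (x - 4^-1)) => ?; case: (leP 0 (x - 2^-1)) => ?; lra.
Qed.

Lemma tent_cdfN x : x <= 0 -> tent_cdf x = 0.
Proof.
by move=> ?; rewrite /tent_cdf /pospart; case: (leP 0 x) => ?;
  case: (leP 0 (x - 4^-1)) => ?; case: (leP 0 (x - 2^-1)) => ?; nra.
Qed.

Lemma tent_cdfP x : 2^-1 <= x -> tent_cdf x = 1.
Proof.
by move=> ?; rewrite /tent_cdf /pospart; case: (leP 0 x) => ?;
  case: (leP 0 (x - 4^-1)) => ?; case: (leP 0 (x - 2^-1)) => ?; nra.
Qed.

Lemma is_derive_taylor (f : R -> R) (l C x : R) :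
  (forall y, `|f y - f x - l * (y - x)| <= C * (y - x) ^+ 2) ->
  is_derive x 1 f l.
Proof.
move=> H.
have C0 : 0 <= C.
  by have := le_trans (normr_ge0 _) (H (x + 1)); rewrite addrAC subrr add0r expr1n mulr1.
have cv : h^-1 *: ((f \o shift x) (h *: 1) - f x) @[h --> 0^'] --> l.
  apply/cvgrPdist_le => e e0.
  near=> h.
  have h0 : h != 0 by near: h; exact: nbhs_dnbhs_neq.
  have := H (h *: 1 + x); rewrite /= addrK /GRing.scale /= mulr1 => Hh.
  have -> : l - h^-1 * (f (h + x) - f x) =
     - (h^-1 * (f (h + x) - f x - l * h)) by field.
  rewrite normrN normrM normfV ler_pdivrMl ?normr_gt0//.
  apply: (le_trans Hh).
  rewrite -real_normK ?num_real// expr2 mulrA mulrC ler_wpM2l//.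
  (* [C + 1] keeps the divisor positive when [C = 0]. *)
  have : `|h| <= e / (C + 1).
    near: h; apply: dnbhs0_le; rewrite divr_gt0//; lra.
  rewrite ler_pdivlMr; last lra.
  by have := normr_ge0 h; nra.
apply: DeriveDef; first by apply/cvg_ex; exists l.
by apply/cvg_lim.
Unshelve. all: by end_near. Qed.
End tent.

Section tent_theory.
Context {R : realType}.
Implicit Types x y h : R.

#[local] Instance is_derive_tent_cdf x : is_derive x 1 tent_cdf (tent x).
Proof. exact/is_derive_taylor/tent_cdf_taylor. Qed.

Lemma continuous_tent_cdf : continuous (@tent_cdf R).
Proof.
by move=> x; apply/differentiable_continuous/derivable1_diffP; exact: ex_derive.
Qed.

Lemma tent_cdf_nondecreasing : {homo @tent_cdf R : x y / x <= y}.
Proof.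
move=> x y xy.
have df z : z \in `]x, y[ -> derivable (@tent_cdf R) z 1.
  by move=> _; exact: ex_derive.
have df0 z : z \in `]x, y[ -> 0 <= derive1 (@tent_cdf R) z.
  by move=> _; rewrite derive1E derive_val; exact: tent_ge0.
apply: (ger0_derive1_ndecr df df0 _ (lexx x) xy (lexx y)).
exact/continuous_subspaceT/continuous_tent_cdf.
Qed.

Lemma tent_cdf_01 x : 0 <= tent_cdf x <= 1.
Proof.
apply/andP; split.
  have [x0|/ltW x0] := leP x 0; first by rewrite tent_cdfN.
  by rewrite -(tent_cdfN (lexx 0)) tent_cdf_nondecreasing.
have [x0|/ltW x0] := leP 2^-1 x; first by rewrite tent_cdfP.
by rewrite -(tent_cdfP (lexx 2^-1)) tent_cdf_nondecreasing.
Qed.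

(** For increments up to 1, 20 = 4 + 16 adds the maximum of the density and the Taylor constant;
    beyond that the range [0, 1] suffices. *)
Lemma tent_cdf_lipschitz x y : `|tent_cdf y - tent_cdf x| <= 20 * `|y - x|.
Proof.
have [d1|d1] := leP `|y - x| 1; last first.
  have := tent_cdf_01 x; have := tent_cdf_01 y => /andP[? ?] /andP[? ?].
  by rewrite ler_norml; apply/andP; split; lra.
have := tent_cdf_taylor x y; have := tent_ge0 x; have := tent_le x.
rewrite -(real_normK (num_real (y - x))) => ? ? H.
have -> : tent_cdf y - tent_cdf x =
  (tent_cdf y - tent_cdf x - tent x * (y - x)) + tent x * (y - x) by ring.
apply: (le_trans (ler_normD _ _)).
rewrite normrM (ger0_norm (tent_ge0 x)).
have ? : `|y - x| * `|y - x| <= 1 * `|y - x| by rewrite ler_wpM2r.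
have ? : tent x * `|y - x| <= 4 * `|y - x| by rewrite ler_wpM2r// tent_le.
move: H; rewrite expr2; lra.
Qed.

(* Follow the tent down from a point until its mass is exhausted: an average
   of a Lipschitz density over a cell controls its end values. *)
Lemma tent_mean_ge (d h M : R) : 0 < h -> 0 <= d ->
  (forall u, 0 <= u <= h -> d * u - 16 * u ^+ 2 <= M) ->
  d ^+ 2 * h <= M * (d + 64 * h) /\ d * h <= M + 16 * h ^+ 2.
Proof.
move=> h0 d0 H; split; last first.
  by have := H h; rewrite (ltW h0) lexx => /(_ isT); lra.
(* [d * u - 16 * u ^+ 2] is maximal at [u = d / 32]; when this exceeds [h], [u = h] is taken. *)
have [dh|dh] := leP d (32 * h).
  have /H : 0 <= d / 32 <= h by rewrite divr_ge0//= ler_pdivrMr// mulrC.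
  have -> : d * (d / 32) - 16 * (d / 32) ^+ 2 = d ^+ 2 / 64 by field.
  rewrite ler_pdivrMr// => HM.
  have M0 : 0 <= M by have := sqr_ge0 d; lra.
  have ? : d ^+ 2 * h <= M * 64 * h by rewrite ler_wpM2r// ltW.
  by have := mulr_ge0 M0 d0; lra.
have := H h; rewrite (ltW h0) lexx => /(_ isT) HM.
have H0 : 0 <= d + 64 * h by have := ltW h0; lra.
apply: le_trans (ler_wpM2r H0 HM).
have : 0 <= h ^+ 2 * (3 * d - 64 * h).
  by rewrite mulr_ge0 ?sqr_ge0//; have := ltW h0; lra.
lra.
Qed.

Lemma tent_mass_left x h : 0 < h ->
  tent x ^+ 2 * h <= (tent_cdf (x + h) - tent_cdf x) * (tent x + 64 * h) /\
  tent x * h <= tent_cdf (x + h) - tent_cdf x + 16 * h ^+ 2.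
Proof.
move=> h0; apply: tent_mean_ge h0 (tent_ge0 _) _.
move=> u /andP[u0 uh].
have : tent_cdf (x + u) <= tent_cdf (x + h) by rewrite tent_cdf_nondecreasing// lerD2l.
have := tent_cdf_taylor x (x + u); rewrite (addrAC x u) subrr add0r ler_norml.
move=> /andP[? ?]; lra.
Qed.

Lemma tent_mass_right x h : 0 < h ->
  tent (x + h) ^+ 2 * h <=
    (tent_cdf (x + h) - tent_cdf x) * (tent (x + h) + 64 * h) /\
  tent (x + h) * h <= tent_cdf (x + h) - tent_cdf x + 16 * h ^+ 2.
Proof.
move=> h0; apply: tent_mean_ge h0 (tent_ge0 _) _.
move=> u /andP[u0 uh].
have : tent_cdf x <= tent_cdf (x + h - u).
  by rewrite tent_cdf_nondecreasing//; lra.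
have := tent_cdf_taylor (x + h) (x + h - u).
rewrite (_ : x + h - u - (x + h) = - u); last by ring.
rewrite ler_norml sqrrN.
move=> /andP[? ?]; lra.
Qed.

End tent_theory.

(** * Means *)

Section mean.
Context {R : realType} (theta : R -> R -> R).
Hypothesis theta_mean : admissible_mean theta.

(** Concavity at the midpoint, doubled by homogeneity. *)
Lemma mean_superadditive a b a' b' : 0 <= a -> 0 <= b -> 0 <= a' -> 0 <= b' ->
  theta a b + theta a' b' <= theta (a + a') (b + b').
Proof.
move=> a0 b0 a'0 b'0.
have t01 : 0 <= (2^-1 : R) <= 1 by apply/andP; split; lra.
have := mean_concave theta_mean t01 a0 b0 a'0 b'0.
have -> : 1 - 2^-1 = 2^-1 :> R by field.
rewrite -!mulrDr (mean_homogeneous theta_mean) ?addr_ge0//; lra.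
Qed.

(** By superadditivity, the increments contribute at least their own mean, which is nonnegative. *)
Lemma mean_mono a b a' b' : 0 <= a <= a' -> 0 <= b <= b' ->
  theta a b <= theta a' b'.
Proof.
move=> /andP[a0 aa'] /andP[b0 bb'].
have da : 0 <= a' - a by lra.
have db : 0 <= b' - b by lra.
have := mean_superadditive a0 b0 da db; rewrite !subrKC.
have := mean_ge0 theta_mean da db; lra.
Qed.

Lemma mean_scale c a b : 0 <= c -> 0 <= a -> 0 <= b ->
  c * theta a b <= theta (c * a) (c * b).
Proof.
rewrite le_eqVlt => /orP[/eqP <- a0 b0|c0 a0 b0].
  by rewrite !mul0r; exact: mean_ge0.
by rewrite (mean_homogeneous theta_mean).
Qed.

Lemma mean_ge_min x a b : 0 <= x -> x <= a -> x <= b -> x <= theta a b.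
Proof.
move=> x0 xa xb.
have := mean_scale x0 ler01 ler01; rewrite (mean_one theta_mean) !mulr1 => H.
by apply: (le_trans H); apply: mean_mono; rewrite x0.
Qed.

Hypothesis theta_sym : symmetric_mean theta.

Lemma mean_reflect h : 0 <= h -> theta (1 + h)^-1 1 = (1 + h)^-1 * theta (1 + h) 1.
Proof.
move=> h0; have h1 : 1 + h != 0 by apply: lt0r_neq0; lra.
rewrite -(mean_homogeneous theta_mean) ?invr_gt0//; [|lra..].
by rewrite mulVf// mulr1 theta_sym ?invr_ge0//; lra.
Qed.

(* By homogeneity and symmetry [theta u 1 = u * theta u^-1 1], so the slope
   of [theta u 1] at [u = 1] is 1/2, strictly above [r]. *)
Lemma mean_gt_slope (r : R) : r < 2^-1 -> exists2 h, 0 < h & 1 + r * h < theta (1 + h) 1.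
Proof.
move=> r2; apply/not_exists2P => Hn.
have Hle h : 0 < h -> theta (1 + h) 1 <= 1 + r * h.
  by move=> h0; case: (Hn h) => // /negP; rewrite -leNgt.
have [_ /(_ (1, 0) (or_introl erefl))[dth _]] := mean_smooth theta_mean 1.
have /(dth (1,1))/cvg_ex[D /= HD] : [set p : R * R | 0 < p.1 /\ 0 < p.2] (1, 1).
  by split.
have e0 : 0 < 2^-1 - r by lra.
have /cvgrPdist_lt/(_ _ e0) := HD.
case/nbhs_ballP => d /= d0 Hd.
have Q h : h != 0 -> `|h| < d -> `|D - h^-1 * (theta (1 + h) 1 - 1)| < 2^-1 - r.
  move=> h0 hd; have := Hd h _ h0.
  rewrite /ball/= sub0r normrN => /(_ hd).
  rewrite /GRing.scale/= mulr1 mulr0 add0r (addrC h) (mean_one theta_mean).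
  done.
pose h := Num.min (d / 2) 1.
have h0 : 0 < h by rewrite lt_min divr_gt0//= ltr01.
have hd : h < d by rewrite gt_min; apply/orP; left; lra.
have := Q h (lt0r_neq0 h0); rewrite gtr0_norm// => /(_ hd).
(* By reflection the difference quotient at [h'] equals [(1 + h - theta (1 + h) 1) / h], which is at
   least [1 - r], while the quotient at [h] is at most [r]. Both are closer than [2^-1 - r] to [D],
   so [D] would lie both above and below 1/2. *)
pose h' := (1 + h)^-1 - 1.
have h'E : h' = - (h / (1 + h)) by rewrite /h'; field; lra.
have h1 : 0 < h / (1 + h) by rewrite divr_gt0//; lra.
have := Q h'; rewrite h'E oppr_eq0 lt0r_neq0// normrN gtr0_norm// => /(_ isT).
have -> : h / (1 + h) < d.
  by rewrite ltr_pdivrMr; [have := mulr_gt0 d0 h0; lra|lra].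
rewrite (_ : 1 - h / (1 + h) = (1 + h)^-1); last by field; lra.
rewrite mean_reflect ?(ltW h0)// => /(_ isT).
rewrite (_ : _ * (_ - 1) = (1 + h - theta (1 + h) 1) / h); last first.
  by field; apply/andP; split; lra.
rewrite !ltr_norml => /andP[A1 A2] /andP[B1 B2].
have := Hle _ h0 => Ht.
have : r * h >= theta (1 + h) 1 - 1 by lra.
rewrite -ler_pdivrMr// mulrC => C1.
have : (1 - r) * h <= 1 + h - theta (1 + h) 1 by lra.
rewrite -ler_pdivlMr// => C2.
lra.
Qed.

Lemma mean_oscillation (r : R) : 0 < r < 2^-1 -> exists alpha : R,
  0 < alpha < 1 /\ 1 < theta (alpha / r) ((1 - alpha) / (1 - r)).
Proof.
move=> /andP[r0 r2]; have [h h0 Hh] := mean_gt_slope r2.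
have rh : 0 < r * h by rewrite mulr_gt0.
have rh0 : 1 + r * h != 0 by lra.
(* Densities [1 + h] and [1] on fractions [r] and [1 - r] of a period average to [1 + r * h]; this
   is the share of the short cell after normalisation. *)
exists (r * (1 + h) / (1 + r * h)); split.
  apply/andP; split; first by rewrite divr_gt0//; [rewrite mulr_gt0//; lra|lra].
  by rewrite ltr_pdivrMr; lra.
have -> : r * (1 + h) / (1 + r * h) / r = (1 + r * h)^-1 * (1 + h).
  by field; apply/andP; split; lra.
have -> : (1 - r * (1 + h) / (1 + r * h)) / (1 - r) = (1 + r * h)^-1 * 1.
  by field; apply/andP; split; lra.
rewrite (mean_homogeneous theta_mean) ?invr_gt0//; [|lra..].
by rewrite ltr_pdivlMl ?mulr1//; lra.
Qed.

End mean.

(** * The dual action on the periodic mesh *)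

Section periodic_mesh_geometry.
Context {R : realType} (r : R) (N : nat).
Hypotheses (r01 : 0 < r < 1) (N0 : (0 < N)%N).
Local Notation T := (periodic_mesh r N).
Implicit Types (k : 'I_N) (K L : T).

Let NR0 : 0 < N%:R :> R. Proof. by rewrite ltr0n. Qed.

Lemma cell_len K :
  cell_right r K - cell_left r K = (if K.2 then 1 - r else r) / N%:R.
Proof.
case: K => k []; rewrite /cell_right /cell_left/= -mulrBl; congr (_ / _).
  by rewrite -natr1; ring.
by ring.
Qed.

Lemma cell_left_lt_right K : cell_left r K < cell_right r K.
Proof.
rewrite -subr_gt0 cell_len divr_gt0//.
by case: K.2; case/andP: r01 => *; lra.
Qed.

Lemma vol_periodic_mesh K : vol K = (if K.2 then 1 - r else r) / N%:R.
Proof.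
rewrite -cell_len /vol /cell/= /periodic_cell; have := cell_left_lt_right K.
by case: ifP => _ lr; rewrite lebesgue_measure_itv/= lte_fin lr.
Qed.

Lemma cell_left_closure K : closure (cell K) (cell_left r K).
Proof.
apply: subset_closure; rewrite /cell/= /periodic_cell; case: ifP => _ /=;
  by rewrite in_itv/= lexx ?(ltW (cell_left_lt_right K)) ?cell_left_lt_right.
Qed.

Lemma cell_right_closure K : closure (cell K) (cell_right r K).
Proof.
have lr := cell_left_lt_right K.
move=> B /nbhs_ballP[e /= e0 eB].
(* The right end may be missing from the cell; [x] is a point of the cell within [e / 2] of it. *)
set x := Num.max (cell_left r K) (cell_right r K - e / 2).
have xl : cell_left r K <= x by rewrite le_max lexx.
have xr : x < cell_right r K by rewrite gt_max lr/=; lra.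
have xe : cell_right r K - e / 2 <= x by rewrite le_max lexx orbT.
exists x; split.
  by rewrite /cell/= /periodic_cell; case: ifP => _ /=; rewrite in_itv/= xl ?(ltW xr).
apply: eB; rewrite /ball/= ger0_norm; lra.
Qed.

Lemma adjacent_periodic_mesh K L : K != L -> cell_right r K = cell_left r L ->
  Defs.adjacent K L /\ Defs.adjacent L K.
Proof.
move=> KL rl; have H : interface K L (cell_right r K).
  by split; [exact: cell_right_closure|rewrite rl; exact: cell_left_closure].
rewrite /Defs.adjacent KL eq_sym KL /=; split; apply/asboolP;
  exists (cell_right r K) => //.
by rewrite /interface setIC.
Qed.

(** Half of [r / N] and half of [(1 - r) / N] add up to [1 / (2 * N)], whichever cell comes
    first. *)
Lemma pt_periodic_mesh K L : cell_right r K = cell_left r L -> K.2 != L.2 ->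
  `|pt K - pt L| = (2 * N%:R)^-1 /\ `|pt L - pt K| = (2 * N%:R)^-1.
Proof.
move=> rl KL2; rewrite (distrC (pt L)); suff -> : `|pt K - pt L| = (2 * N%:R)^-1 by [].
have := cell_len K; have := cell_len L; rewrite /pt/= rl => HL HK.
rewrite (_ : _ - _ = - ((cell_right r L - cell_left r L +
   (cell_left r L - cell_left r K)) / 2)); last by field.
rewrite HL HK normrN ger0_norm; last first.
  rewrite divr_ge0// addr_ge0// divr_ge0 ?ler0n//.
    by case: (L.2); case/andP: r01 => *; lra.
  by case: (K.2); case/andP: r01 => *; lra.
by move: KL2; case: (K.2); case: (L.2) => // _; field; exact: lt0r_neq0.
Qed.

End periodic_mesh_geometry.

Lemma sum_ge2 (R : numDomainType) (I : finType) (P : pred I) (F : I -> R) (x y : I) :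
  (forall i, 0 <= F i) -> P x -> P y -> x != y ->
  F x + F y <= \sum_(i | P i) F i.
Proof.
move=> F0 Px Py xy; rewrite (bigD1 x)//= (bigD1 y)/=; last by rewrite Py eq_sym.
by rewrite lerD2l lerDl sumr_ge0.
Qed.

Lemma sum_ge1 (R : numDomainType) (I : finType) (P : pred I) (F : I -> R) (x : I) :
  (forall i, 0 <= F i) -> P x -> F x <= \sum_(i | P i) F i.
Proof. by move=> F0 Px; rewrite (bigD1 x)//= lerDl sumr_ge0. Qed.

(** Young's inequality multiplied through by [w]. Writing [J ^+ 2 <= B * w] instead of a quotient
    covers a vanishing mobility, which forces [J = 0]. *)
Lemma flux_young (R : realFieldType) (J B w D : R) : 0 <= w -> 0 <= B ->
  J ^+ 2 <= B * w -> 2 * (J * D) - w * D ^+ 2 <= B.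
Proof.
rewrite le_eqVlt => /orP[/eqP <- B0|w0 B0 JB].
  rewrite mulr0 => JB; have /eqP : J ^+ 2 = 0.
    by apply/eqP; rewrite eq_le JB sqr_ge0.
  by rewrite expf_eq0/= => /eqP ->; rewrite !mul0r mulr0 subr0.
rewrite -(ler_pM2r w0); apply: le_trans JB.
have := sqr_ge0 (J - w * D); lra.
Qed.

(** * Bounding the dual action by fluxes along the path of cells *)

Section dual_action_bound.
Context {R : realType} (theta : R -> R -> R) (r : R) (n : nat).
Hypotheses (theta_mean : admissible_mean theta) (theta_sym : symmetric_mean theta).
Hypothesis r01 : 0 < r < 1.
Local Notation N := n.+1.
Local Notation T := (periodic_mesh r N).
Variables (m sigma : T -> R) (a b : nat -> R).
Hypotheses (m0 : forall K, 0 <= m K).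
Hypothesis ma : forall k : 'I_N, m (k, false) / vol ((k, false) : T) = a k.
Hypothesis mb : forall k : 'I_N, m (k, true) / vol ((k, true) : T) = b k.

Let w (psi : T -> R) (K L : T) := 1 / `|pt K - pt L| *
  theta (m K / vol K) (m L / vol L) * (psi K - psi L) ^+ 2.

Let dens0 (K : T) : 0 <= m K / vol K.
Proof.
rewrite divr_ge0// vol_periodic_mesh// divr_ge0//.
by case: (K.2); case/andP: r01 => *; lra.
Qed.

Let w0 psi K L : 0 <= w psi K L.
Proof.
by rewrite mulr_ge0 ?sqr_ge0// mulr_ge0 ?divr_ge0//; exact: mean_ge0.
Qed.

Let wE psi (K L : T) : cell_right r K = cell_left r L -> K.2 != L.2 ->
  w psi K L = 2 * N%:R * theta (m K / vol K) (m L / vol L) * (psi K - psi L) ^+ 2 /\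
  w psi L K = w psi K L.
Proof.
move=> rl KL2; have [d1 d2] := pt_periodic_mesh r01 (ltn0Sn n) rl KL2.
rewrite /w d1 d2 div1r invrK; split => //.
by rewrite theta_sym// -sqrrN opprB.
Qed.

(** [wI] is the energy of the link inside period [k], [wL] that of the link between periods [k] and
    [k.+1]; [2 * N] is the inverse distance of the midpoints. *)
Let wI psi (k : 'I_N) := 2 * N%:R * theta (a k) (b k) *
  (psi ((k, false) : T) - psi (k, true)) ^+ 2.
Let wL (psi : T -> R) (k : nat) := 2 * N%:R * theta (b k) (a k.+1) *
  (psi (inord k, true) - psi (inord k.+1, false)) ^+ 2.

Let inner_edge (k : 'I_N) : cell_right r ((k, false) : T) = cell_left r ((k, true) : T).
Proof. by []. Qed.

Let inner_neq (k : 'I_N) : ((k, false) : T) != (k, true).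
Proof. by apply/eqP => -[]. Qed.

Let outer_edge (k : 'I_N) (l : 'I_N) : k.+1 = l ->
  cell_right r ((k, true) : T) = cell_left r ((l, false) : T).
Proof. by rewrite /cell_right/cell_left/= => ->. Qed.

Let wIE psi k : w psi (k, false) (k, true) = wI psi k /\
  w psi (k, true) (k, false) = wI psi k.
Proof.
have [e1 e2] := wE psi (inner_edge k) isT.
by rewrite e2 e1 /wI ma mb.
Qed.

Let wLE psi (k : nat) : (k < n)%N ->
  w psi (inord k, true) (inord k.+1, false) = wL psi k /\
  w psi (inord k.+1, false) (inord k, true) = wL psi k.
Proof.
move=> kn.
have kE : (inord k : 'I_N) = k :> nat by rewrite inordK// ltnW.
have k1E : (inord k.+1 : 'I_N) = k.+1 :> nat by rewrite inordK.
have [||e1 e2] := @wE psi (inord k, true) (inord k.+1, false).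
- by apply: outer_edge; rewrite kE k1E.
- by [].
by rewrite e2 e1 /wL ma mb kE k1E.
Qed.

(** Every link of the path joins a short and a long cell, so the sums over short and over long cells
    each contain all links once; the factor 1/2 compensates. A lower bound suffices because the
    action enters the dual action with a minus sign. *)
Lemma action_ge_path psi :
  \sum_k wI psi k + \sum_(k < n) wL psi k <= action (fun _ _ => theta) m psi.
Proof.
rewrite ler_pdivlMl// (_ : \sum_K _ =
    \sum_(k < N) \sum_(L | Defs.adjacent ((k,false) : T) L) w psi (k, false) L +
    \sum_(k < N) \sum_(L | Defs.adjacent ((k,true) : T) L) w psi (k, true) L);
    last first.
  rewrite -big_split/= (eq_bigr (fun k : 'I_N => \sum_(c : bool)
      \sum_(L | Defs.adjacent ((k, c) : T) L) w psi (k, c) L)); last first.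
    by move=> k _; rewrite big_bool addrC.
  by rewrite pair_bigA/=; apply: eq_bigr => -[].
have E1 : \sum_(k < N) wI psi k + \sum_(k < n) wL psi k <=
    \sum_(k < N) \sum_(L | Defs.adjacent ((k,false) : T) L) w psi (k, false) L.
  (* Seen from the short cells, link [k'] belongs to period [k'.+1]; the first short cell has no
     left neighbour. *)
  have -> : \sum_(k < n) wL psi k =
      \sum_(k < N) (if (k : nat) is k'.+1 then wL psi k' else 0).
    by rewrite big_ord_recl add0r.
  rewrite -big_split /=; apply: ler_sum => k _.
  have [A1 _] := adjacent_periodic_mesh r01 (ltn0Sn n) (inner_neq k) (inner_edge k).
  case E : (k : nat) => [|k'].
    by rewrite addr0 -(wIE psi k).1; exact: sum_ge1.
  have k'n : (k' < n)%N by rewrite -ltnS -E.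
  have kE : k = inord k'.+1 by apply/val_inj; rewrite /= inordK// -E.
  rewrite -(wIE psi k).1 -(wLE psi k'n).2 -kE; apply: (sum_ge2 (w0 psi _) A1); last first.
    by apply/eqP => -[/(congr1 val)] /= /eqP; rewrite E inordK ?gtn_eqF// ltnW.
  apply: (adjacent_periodic_mesh r01 (ltn0Sn n) _ _).2; first by apply/eqP => -[].
  by apply: outer_edge; rewrite E inordK// ltnW.
have E2 : \sum_(k < N) wI psi k + \sum_(k < n) wL psi k <=
    \sum_(k < N) \sum_(L | Defs.adjacent ((k,true) : T) L) w psi (k, true) L.
  (* Seen from the long cells, link [k] belongs to period [k]; the last long cell has no right
     neighbour. *)
  have -> : \sum_(k < n) wL psi k =
      \sum_(k < N) (if (k < n)%N then wL psi k else 0).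
    rewrite big_ord_recr/= ltnn addr0; apply: eq_bigr => i _.
    by rewrite ltn_ord.
  rewrite -big_split /=; apply: ler_sum => k _.
  have [_ A1] := adjacent_periodic_mesh r01 (ltn0Sn n) (inner_neq k) (inner_edge k).
  case: ifP => kn; last first.
    by rewrite addr0 -(wIE psi k).2; exact: sum_ge1.
  rewrite -(wIE psi k).2 -(wLE psi kn).1 inord_val.
  apply: (sum_ge2 (w0 psi _) A1); last first.
    by apply/eqP => -[/(congr1 val)] /= /eqP; rewrite inordK// ltn_eqF.
  apply: (adjacent_periodic_mesh r01 (ltn0Sn n) _ _).1; first by apply/eqP => -[].
  by apply: outer_edge; rewrite inordK.
lra.
Qed.

(** Here [L k] is the flux entering period [k] from the left and [I k] the flux from its short to
    its long cell, so [sigma] is minus their divergence. Summation by parts pairs fluxes with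
    differences of [psi], and [flux_young] is applied link by link. *)
Lemma dual_action_le_flux (I L BI BL : nat -> R) :
  L 0%N = 0 -> L N = 0 ->
  (forall k : 'I_N, sigma (k, false) = L k - I k) ->
  (forall k : 'I_N, sigma (k, true) = I k - L k.+1) ->
  (forall k, (k < N)%N -> 0 <= BI k /\
    I k ^+ 2 <= BI k * (2 * N%:R * theta (a k) (b k))) ->
  (forall k, (k < n)%N -> 0 <= BL k /\
    L k.+1 ^+ 2 <= BL k * (2 * N%:R * theta (b k) (a k.+1))) ->
  (dual_action (fun _ _ => theta) m sigma <=
    (\sum_(k < N) BI k + \sum_(k < n) BL k)%:E)%E.
Proof.
move=> L0 LN sf st HI HL; apply: ge_ereal_sup => _ [psi _ <-].
rewrite lee_fin.
have a0 k : (k < N)%N -> 0 <= a k.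
  by move=> kN; have := dens0 (Ordinal kN, false); rewrite ma.
have b0 k : (k < N)%N -> 0 <= b k.
  by move=> kN; have := dens0 (Ordinal kN, true); rewrite mb.
have -> : \sum_K psi K * sigma K =
    \sum_(k < N) I k * (psi ((k, true) : T) - psi (k, false)) +
    \sum_(k < n) L k.+1 * (psi (inord k.+1, false) - psi (inord k, true)).
  transitivity (\sum_(k < N) \sum_(c : bool) psi ((k, c) : T) * sigma (k, c)).
    by rewrite pair_bigA/=; apply: eq_bigr => -[].
  transitivity (\sum_(k < N) I k * (psi ((k, true) : T) - psi (k, false)) +
     (\sum_(k < N) L k * psi (inord k, false) -
      \sum_(k < N) L k.+1 * psi (inord k, true))).
    rewrite -sumrB -big_split/=; apply: eq_bigr => k _.
    by rewrite big_bool/= sf st inord_val; ring.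
  (* The vanishing boundary fluxes remove one end term from each sum, so that both run over the same
     [n] links. *)
  congr (_ + _); rewrite big_ord_recl L0 mul0r add0r big_ord_recr/= LN mul0r addr0.
  by rewrite -sumrB; apply: eq_bigr => k _; rewrite /= mulrBr.
apply: le_trans (lerB (lexx _) (action_ge_path psi)) _.
rewrite mulrDr opprD addrACA; apply: lerD.
  rewrite !mulr_sumr -sumrB; apply: ler_sum => k _.
  have [B0 HB] := HI k (ltn_ord k).
  rewrite /wI -(sqrrN (psi _ - _)) opprB; apply: flux_young => //.
  by rewrite mulr_ge0// mean_ge0// ?a0// b0.
rewrite !mulr_sumr -sumrB; apply: ler_sum => k _.
have [B0 HB] := HL k (ltn_ord k).
rewrite /wL -(sqrrN (psi _ - _)) opprB; apply: flux_young => //.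
by rewrite mulr_ge0// mean_ge0// ?a0 ?b0// ltnS// ltnW.
Qed.

End dual_action_bound.

(** * The endpoint measures and their Wasserstein distance *)

Section tent_measure.
Context {R : realType}.

Let tent_cdf_rc : right_continuous (@tent_cdf R).
Proof. exact/right_continuousW/continuous_tent_cdf. Qed.

HB.instance Definition _ :=
  isCumulative.Build R _ R tent_cdf tent_cdf_nondecreasing tent_cdf_rc.

Let tent_cdfNy : tent_cdf @ -oo --> (0 : R).
Proof.
apply: cvg_near_cst; near=> x; rewrite tent_cdfN//.
Unshelve. all: end_near. Qed.

Let tent_cdfy : tent_cdf @ +oo --> (1 : R).
Proof.
apply: cvg_near_cst; near=> x; rewrite tent_cdfP//.
Unshelve. all: end_near. Qed.

HB.instance Definition _ :=
  isCumulativeBounded.Build R 0 1 tent_cdf tent_cdfNy tent_cdfy.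

(** Built from the distribution function rather than the density, so that masses of cells are
    differences of [tent_cdf]. *)
Definition tent_measure : probability (measurableTypeR R) R :=
  lebesgue_stieltjes_measure (tent_cdf : cumulativeBounded (0:R) (1:R)).

Lemma tent_measure_itvoc (a b : R) : a <= b ->
  tent_measure `]a, b]%classic = (tent_cdf b - tent_cdf a)%:E.
Proof.
move=> ab.
rewrite /tent_measure/= /lebesgue_stieltjes_measure /measure_extension.
by rewrite measurable_mu_extE/=; [rewrite wlength_itv_bnd|exact: is_ocitv].
Qed.

(** By the Lipschitz constant 20 of [tent_cdf], the interval []a - e / 20, a]] has mass at most
    [e]. *)
Lemma tent_measure_set1 (a : R) : tent_measure [set a] = 0%E.
Proof.
apply/eqP; rewrite eq_le measure_ge0 andbT; apply/lee_addgt0Pr => e e0.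
rewrite add0e.
have d0 : 0 < e / 20 by rewrite divr_gt0.
apply: (@le_trans _ _ (tent_measure `]a - e / 20, a]%classic)).
  apply: le_measure; rewrite ?inE//=.
  by move=> _ -> /=; rewrite in_itv/= lexx andbT; lra.
rewrite tent_measure_itvoc; last lra.
rewrite lee_fin; have := tent_cdf_lipschitz (a - e / 20) a.
rewrite ler_norml => /andP[_]; rewrite ger0_norm; lra.
Qed.

Lemma tent_measure_itv (x y : bool) (a b : R) : a < b ->
  tent_measure [set` Interval (BSide x a) (BSide y b)] =
    (tent_cdf b - tent_cdf a)%:E.
Proof.
move=> ab; rewrite -tent_measure_itvoc ?ltW//.
have oo : tent_measure `]a, b]%classic = tent_measure `]a, b[%classic.
  rewrite -(@setUitv1 _ _ (BSide false a) b true)//= measureU//=.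
  - by rewrite tent_measure_set1 adde0.
  - by apply/seteqP; split => z //= [] /[swap] ->; rewrite in_itv/= ltxx andbF.
have add1 (i : bool) : tent_measure [set` Interval (BSide true a) (BSide i b)] =
    tent_measure [set` Interval (BSide false a) (BSide i b)].
  rewrite -(@setU1itv _ _ (BSide i b) a false)//=; last first.
    by case: i; rewrite bnd_simp// ltW.
  rewrite measureU//=; last first.
    by apply/seteqP; split => z //= [] ->; rewrite in_itv/= ltxx.
  by rewrite tent_measure_set1 add0e.
by case: x; case: y; rewrite ?add1.
Qed.

Definition translation (s : R) : measurableTypeR R -> measurableTypeR R :=
  fun x => x + s.

Lemma measurable_translation s : measurable_fun setT (translation s).
Proof.
by apply: measurable_funD; [exact: measurable_id|exact: measurable_cst].
Qed.

HB.instance Definition _ s :=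
  isMeasurableFun.Build _ _ _ _ (translation s) (measurable_translation s).

Definition shifted_tent (s : R) : probability (measurableTypeR R) R :=
  distribution tent_measure (translation s : {mfun _ >-> _}).

Lemma shifted_tent_itv (s : R) (x y : bool) (a b : R) : a < b ->
  shifted_tent s [set` Interval (BSide x a) (BSide y b)] =
    (tent_cdf (b - s) - tent_cdf (a - s))%:E.
Proof.
move=> ab.
rewrite -(tent_measure_itv x y); last by rewrite ltrD2r.
congr (tent_measure _); apply/seteqP; split => z /=; rewrite /translation !in_itv/=;
 by case: x; case: y; rewrite /= ?lerBlDr ?ltrBlDr ?lerBrDr ?ltrBrDr.
Qed.

End tent_measure.

(** The triangle inequality and the square of [|x - y| - s]. It bounds the quadratic cost below by
    first moments, which every coupling shares. *)
Lemma young_dist (R : realDomainType) (s x y : R) : 0 <= s ->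
  2 * s * `|y| <= `|x - y| ^+ 2 + (2 * s * `|x| + s ^+ 2).
Proof.
move=> s0; have H : `|y| <= `|x - y| + `|x|.
  by have := ler_normB x (x - y); rewrite subKr addrC.
have := ler_wpM2l s0 H; have := sqr_ge0 (`|x - y| - s); lra.
Qed.

(** * Lower bound of the Wasserstein distance by the difference of means *)

Section W2_lower_bound.
Context {R : realType}.
Local Open Scope ereal_scope.

Lemma tent_measure_ae (U : Type) (f g : measurableTypeR R -> U) :
  (forall x : R, (0 <= x <= 1)%R -> f x = g x) -> ae_eq tent_measure setT f g.
Proof.
move=> fg.
exists (~` `[0%R, 1%R]%classic); split.
- by apply: measurableC; exact: measurable_itv.
- transitivity (1 - (@tent_measure R) `[0%R, 1%R]%classic).
    by apply: probability_setC; exact: measurable_itv.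
  rewrite tent_measure_itv//= tent_cdfP ?tent_cdfN//; last lra.
  by rewrite subr0 subee.
- by move=> x /= Hx; rewrite in_itv/= => H; apply: Hx => _; exact: fg.
Qed.

Let mnorm : measurable_fun setT (fun x : measurableTypeR R => `|x|%:E).
Proof.
by apply/measurable_EFinP; exact: normr_measurable.
Qed.

Let mnormr (s : R) : measurable_fun setT (fun x : measurableTypeR R => `|x + s|%:E).
Proof.
apply/measurable_EFinP; apply: (measurableT_comp (f := fun y : R => `|y|%R)).
  exact: normr_measurable.
exact: measurable_translation.
Qed.

(** Absolute values keep the integrands nonnegative; on [0, 1], which carries the tent, they do not
    change the mean. *)
Lemma shifted_tent_mean (s : R) : (0 <= s)%R ->
  \int[shifted_tent s]_x `|x|%:E = \int[tent_measure]_x `|x|%:E + s%:E.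
Proof.
move=> s0; rewrite (ge0_integral_distribution _ mnorm)//.
transitivity (\int[tent_measure]_x (`|x|%:E + s%:E)).
  apply: ge0_ae_eq_integral => //.
  - exact: mnormr.
  - by apply: emeasurable_funD => //; exact: mnorm.
  - by move=> x _; rewrite lee_fin.
  - by move=> x _; rewrite -EFinD lee_fin addr_ge0.
  - apply: tent_measure_ae => x /andP[x0 _] /=.
    by rewrite /translation -EFinD ger0_norm ?addr_ge0// ger0_norm.
rewrite ge0_integralD//.
by rewrite integral_cst//= probability_setT mule1.
Qed.

(** The absolute value may be truncated at 1 on the support. Finiteness allows the mean to be
    cancelled in [W2_shifted_tent]. *)
Lemma tent_mean_fin : \int[tent_measure]_x `|x|%:E \is a @fin_num R.
Proof.
rewrite ge0_fin_numE ?integral_ge0//; apply: (@le_lt_trans _ _ 1); last exact: ltry.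
have mmin : measurable_fun setT (fun x : measurableTypeR R => (Num.min `|x| 1)%:E).
  by apply/measurable_EFinP; apply: measurable_minr => //; exact: normr_measurable.
have -> : \int[tent_measure]_x `|x|%:E =
    \int[tent_measure]_x (Num.min `|x| 1)%:E :> \bar R.
  apply: ge0_ae_eq_integral => //.
  apply: tent_measure_ae => x /andP[x0 x1] /=.
    by rewrite ger0_norm// min_l.
apply: (@le_trans _ _ (\int[tent_measure]_x (cst 1 x))).
  apply: ge0_le_integral => //.
  by move=> x _; rewrite lee_fin ge_min lexx orbT.
by rewrite integral_cst//= probability_setT mule1.
Qed.

Lemma coupling_integral (mu nu : probability (measurableTypeR R) R) g :
  coupling mu nu g ->
  \int[g]_p `|p.1|%:E = \int[mu]_x `|x|%:E /\
  \int[g]_p `|p.2|%:E = \int[nu]_x `|x|%:E.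
Proof.
move=> cg; split.
  rewrite -(@ge0_integral_pushforward _ _ _ _ _ fst _ g setT
    (fun x : measurableTypeR R => `|x|%:E))//.
  by apply: eq_measure_integral => A mA _; exact: (cg A mA).1.
rewrite -(@ge0_integral_pushforward _ _ _ _ _ snd _ g setT
  (fun x : measurableTypeR R => `|x|%:E))//.
by apply: eq_measure_integral => A mA _; exact: (cg A mA).2.
Qed.

Lemma W2_shifted_tent (s : R) : (0 <= s)%R ->
  s%:E <= W2 (shifted_tent 0) (shifted_tent s).
Proof.
move=> s0; apply: le_ereal_inf_tmp => _ [g cg <-].
have -> : s%:E = sqrte (s ^+ 2)%:E by rewrite /= sqrtr_sqr ger0_norm.
rewrite lee_sqrt; last by apply: integral_ge0 => p _; rewrite lee_fin sqr_ge0.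
have [I1 I2] := coupling_integral cg.
have mfst : measurable_fun setT
    (fun p : measurableTypeR R * measurableTypeR R => `|p.1|%:E).
  by apply: (measurableT_comp mnorm); exact: measurable_fst.
have msnd : measurable_fun setT
    (fun p : measurableTypeR R * measurableTypeR R => `|p.2|%:E).
  by apply: (measurableT_comp mnorm); exact: measurable_snd.
have msq : measurable_fun setT
    (fun p : measurableTypeR R * measurableTypeR R => (`|p.1 - p.2| ^+ 2)%:E).
  apply/measurable_EFinP; apply: measurable_funX.
  apply: (measurableT_comp (f := fun y : R => `|y|%R)).
    exact: normr_measurable.
  by apply: measurable_funB; [exact: measurable_fst|exact: measurable_snd].
have := shifted_tent_mean s0; have := shifted_tent_mean (lexx 0).
have /EFin_fin_numP := tent_mean_fin.
move=> [c ->]; rewrite adde0 -EFinD => E0 Es.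
(* This is [young_dist] integrated against the coupling. With first moments [c] and [c + s] it reads
   [2 * s * (c + s) <= cost + 2 * s * c + s ^+ 2], hence [s ^+ 2 <= cost]. *)
have : \int[g]_p ((2 * s)%:E * `|p.2|%:E) <=
    \int[g]_p ((`|p.1 - p.2| ^+ 2)%:E + ((2 * s)%:E * `|p.1|%:E + (s ^+ 2)%:E)).
  apply: ge0_le_integral => //.
  - by move=> p _; rewrite mule_ge0// lee_fin mulr_ge0.
  - exact: measurable_funeM.
  - apply: emeasurable_funD => //; apply: emeasurable_funD => //.
    exact: measurable_funeM.
  - by move=> [x y] _; rewrite -!EFinM -!EFinD lee_fin; exact: young_dist.
rewrite ge0_integralZl//; last by rewrite lee_fin mulr_ge0.
rewrite ge0_integralD//; last 2 first.
- by move=> p _; rewrite -!EFinM -!EFinD lee_fin addr_ge0 ?sqr_ge0// mulr_ge0// mulr_ge0.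
- by apply: emeasurable_funD => //; exact: measurable_funeM.
rewrite ge0_integralD//; last 3 first.
- by move=> p _; rewrite -!EFinM lee_fin mulr_ge0// mulr_ge0.
- exact: measurable_funeM.
- by move=> p _; rewrite lee_fin sqr_ge0.
rewrite ge0_integralZl//; last by rewrite lee_fin mulr_ge0.
rewrite integral_cst//= probability_setT mule1 I1 I2 E0 Es -!EFinM -EFinD.
have : 0 <= \int[g]_p (`|p.1 - p.2| ^+ 2)%:E.
  by apply: integral_ge0 => p _; rewrite lee_fin sqr_ge0.
case: (\int[g]_p _) => [x| |]//=; rewrite ?leey// -EFinD !lee_fin => _; lra.
Qed.
End W2_lower_bound.

(** * Integration in time and Lipschitz curves *)

(** The integral of a nonnegative function is a supremum over simple functions below it. This form
    applies to the dual action along a curve, whose measurability in time is not established. *)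
Lemma ge0_le_integral_nonmeasurable d (T : measurableType d) (R : realType)
    (mu : {measure set T -> \bar R}) (D : set T) (f g : T -> \bar R) :
  (forall x, D x -> (0 <= f x)%E) -> (forall x, D x -> (f x <= g x)%E) ->
  (\int[mu]_(x in D) f x <= \int[mu]_(x in D) g x)%E.
Proof.
move=> f0 fg; have g0 x (Dx : D x) : (0 <= g x)%E := le_trans (f0 x Dx) (fg x Dx).
rewrite !ge0_integralE//; apply: ereal_sup_le => _ [h hf <-]; exists h => // x.
by apply: (le_trans (hf x)); apply: lee_restrict.
Qed.

Lemma integral_le_step (R : realType) (f : R -> \bar R) (E1 E2 a b : R) (S : set R) :
  0 <= E1 -> 0 <= E2 -> 0 <= a < b -> b <= 1 -> finite_set S ->
  (forall t, 0 <= t <= 1 -> (0 <= f t)%E) ->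
  (forall t, 0 <= t <= 1 -> ~ S t -> (f t <= (E1 + E2 * \1_(`]a, b[%classic) t)%:E)%E) ->
  (\int[@lebesgue_measure R]_(t in `[0%R, 1%R]) f t <= (E1 + E2 * (b - a))%:E)%E.
Proof.
move=> E10 E20 /andP[a0 ab] b1 finS f0 fE.
have mS : measurable (S : set (measurableTypeR R)).
  by apply: countable_measurable => //; exact: finite_set_countable.
have S0 : @lebesgue_measure R S = 0%E.
  by apply: countable_lebesgue_measure0; exact: finite_set_countable.
pose I := `]a, b[%classic : set (measurableTypeR R).
have mI : measurable I by exact: measurable_itv.
pose D := `[0, 1]%classic : set (measurableTypeR R).
have mD : measurable D by exact: measurable_itv.
(* The infinite value on [S] dominates [f] at the exceptional times and integrates to zero because
   [S] is null. *)
pose g (t : measurableTypeR R) : \bar R :=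
  (E1%:E + (E2%:E * (\1_I t)%:E + +oo * (\1_S t)%:E))%E.
have le1 : (\int[@lebesgue_measure R]_(t in D) f t <=
    \int[@lebesgue_measure R]_(t in D) g t)%E.
  apply: ge0_le_integral_nonmeasurable => t; rewrite /D/= in_itv/= => t01.
    exact: f0.
  rewrite /g; have [tS|tS] := pselect (S t).
    by rewrite [\1_S t]indicE mem_set//= mule1 addey// leey.
  have tS' : (t \in S) = false by apply/negP => /set_mem.
  rewrite [\1_S t]indicE tS'/= mule0 adde0 -EFinM -EFinD.
  exact: fE.
apply: (le_trans le1).
have mIf : measurable_fun D (fun t : measurableTypeR R => (\1_I t : R)%:E).
  by apply/measurable_EFinP; exact: measurable_indic.
have mSf : measurable_fun D (fun t : measurableTypeR R => (\1_S t : R)%:E).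
  by apply/measurable_EFinP; exact: measurable_indic.
have I0 t : (0 <= (\1_I t)%:E :> \bar R)%E by rewrite lee_fin.
have SS0 t : (0 <= (\1_S t)%:E :> \bar R)%E by rewrite lee_fin.
rewrite ge0_integralD//; last 2 first.
- by move=> t _; rewrite adde_ge0// mule_ge0.
- by apply: emeasurable_funD; exact: measurable_funeM.
rewrite integral_cst// ge0_integralD//; last 3 first.
- by move=> t _; rewrite mule_ge0.
- exact: measurable_funeM.
- exact: measurable_funeM.
rewrite !ge0_integralZl//.
rewrite !integral_indic// setIidl; last first.
  by move=> t; rewrite /I/D/= !in_itv/= => /andP[? ?]; apply/andP; split; lra.
rewrite [X in (+oo * X)%E](_ : _ = 0%E); last first.
  by apply: subset_measure0 S0 => //; exact: measurableI.
have LD : @lebesgue_measure R `[0, 1]%classic = 1%E.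
  by rewrite lebesgue_measure_itv/= lte_fin ltr01 oppr0 adde0.
have LI : @lebesgue_measure R `]a, b[%classic = (b - a)%:E.
  by rewrite lebesgue_measure_itv/= lte_fin ab.
rewrite mule0 adde0 [X in (E1%:E * X)%E]LD [X in (E2%:E * X)%E]LI.
by rewrite mule1.
Qed.

(** * Lipschitz functions on the unit time interval *)

Section lipschitz.
Context {R : realType}.
Implicit Types f g : R -> R.

Definition lip01 f := exists2 K, 0 <= K &
  forall x y, 0 <= x <= 1 -> 0 <= y <= 1 -> `|f x - f y| <= K * `|x - y|.

Lemma lip01_bounded f : lip01 f -> exists2 B, 0 <= B &
  forall x, 0 <= x <= 1 -> `|f x| <= B.
Proof.
move=> [K K0 H]; exists (K + `|f 0|); first by rewrite addr_ge0.
move=> x x01; have := H x 0 x01; rewrite lexx ler01 subr0 => /(_ isT) Hx.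
rewrite -[f x](subrK (f 0)); apply: (le_trans (ler_normD _ _)).
rewrite lerD2r; apply: (le_trans Hx); case/andP: x01 => x0 x1.
by rewrite ger0_norm// ler_piMr.
Qed.

Lemma lip01_cst c : lip01 (fun=> c).
Proof. by exists 0 => // x y _ _; rewrite subrr normr0 mul0r. Qed.

Lemma lip01_id : lip01 (fun x => x).
Proof. by exists 1 => // x y _ _; rewrite mul1r. Qed.

Lemma lip01D f g : lip01 f -> lip01 g -> lip01 (fun x => f x + g x).
Proof.
move=> [K K0 Hf] [L L0 Hg]; exists (K + L); first exact: addr_ge0.
move=> x y x01 y01; rewrite mulrDl opprD addrACA.
by apply: (le_trans (ler_normD _ _)); rewrite lerD ?Hf ?Hg.
Qed.

Lemma lip01M f g : lip01 f -> lip01 g -> lip01 (fun x => f x * g x).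
Proof.
move=> lf lg; have [B B0 Bf] := lip01_bounded lf; have [C C0 Cg] := lip01_bounded lg.
case: lf lg => [K K0 Hf] [L L0 Hg].
exists (B * L + K * C); first by rewrite addr_ge0// mulr_ge0.
move=> x y x01 y01.
rewrite (_ : _ - _ = f x * (g x - g y) + (f x - f y) * g y); last by ring.
apply: (le_trans (ler_normD _ _)); rewrite !normrM mulrDl lerD//.
  by rewrite -mulrA ler_pM// ?Bf// Hg.
by rewrite mulrAC ler_pM// ?Cg// Hf.
Qed.

Lemma lip01N f : lip01 f -> lip01 (fun x => - f x).
Proof.
move=> [K K0 Hf]; exists K => // x y x01 y01.
by rewrite -opprD normrN Hf.
Qed.

Lemma lip01_comp f g K : 0 <= K -> (forall x y, `|f x - f y| <= K * `|x - y|) ->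
  lip01 g -> lip01 (fun x => f (g x)).
Proof.
move=> K0 Hf [L L0 Hg]; exists (K * L); first exact: mulr_ge0.
move=> x y x01 y01; apply: (le_trans (Hf _ _)).
by rewrite -mulrA ler_wpM2l// Hg.
Qed.

Lemma lip01_min f g : lip01 f -> lip01 g -> lip01 (fun x => Num.min (f x) (g x)).
Proof.
move=> [K K0 Hf] [L L0 Hg]; exists (K + L); first exact: addr_ge0.
move=> x y x01 y01; rewrite mulrDl.
have := Hf x y x01 y01; have := Hg x y x01 y01.
rewrite !ler_norml => /andP[? ?] /andP[? ?].
have ? := mulr_ge0 K0 (normr_ge0 (x - y)); have ? := mulr_ge0 L0 (normr_ge0 (x - y)).
by case: (leP (f x) (g x)) => ?; case: (leP (f y) (g y)) => ?; apply/andP; split; lra.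
Qed.

Lemma lip01_abs_continuous f : lip01 f -> abs_continuous 0 1 f.
Proof.
move=> [K K0 Hf] e e0; exists (e / (K + 1)); first by rewrite divr_gt0// ltr_wpDl.
move=> n s t st _ sum_lt.
apply: (@le_lt_trans _ _ (\sum_i K * (t i - s i))).
  apply: ler_sum => i _; have [s0 [sti t1]] := st i.
  rewrite -[t i - s i]ger0_norm ?subr_ge0//; apply: Hf; apply/andP; split => //.
    exact: le_trans sti.
  exact: le_trans t1.
rewrite -mulr_sumr; have K1 : 0 < K + 1 by rewrite ltr_wpDl.
move: sum_lt; rewrite ltr_pdivlMr// => H.
apply: le_lt_trans H; rewrite mulrDr mulr1 mulrC lerDl.
by apply: sumr_ge0 => i _; rewrite subr_ge0; case: (st i) => _ [].
Qed.

End lipschitz.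

(** * The oscillating competitor *)

Section cell_masses.
Context {R : realType}.
Variables (r alpha : R) (n : nat).
Hypotheses (r01 : 0 < r < 1) (a01 : 0 < alpha < 1).
Local Notation N := n.+1.
Local Notation h := (N%:R^-1 : R).
Implicit Types (k : nat) (c s : R).

Definition period_mass k s : R :=
  tent_cdf (k.+1%:R / N%:R - s) - tent_cdf (k%:R / N%:R - s).

Definition short_mass k s : R :=
  tent_cdf ((k%:R + r) / N%:R - s) - tent_cdf (k%:R / N%:R - s).

(* At [c = 0] the projection of the shifted tent; at [c = 1] each period is
   redistributed in proportions [alpha], [1 - alpha] to its two cells. *)
Definition mixed_mass c k s : R :=
  (1 - c) * short_mass k s + c * (alpha * period_mass k s).

Definition mixed_state c s : periodic_mesh r N -> R := fun K =>
  if K.2 then period_mass K.1 s - mixed_mass c K.1 s else mixed_mass c K.1 s.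

Let h0 : 0 < h. Proof. by rewrite invr_gt0 ltr0n. Qed.

Lemma nodeS k s : k.+1%:R / N%:R - s = k%:R / N%:R - s + h.
Proof. by rewrite -natr1 mulrDl mul1r addrAC. Qed.

Lemma period_mass_ge0 k s : 0 <= period_mass k s.
Proof.
by rewrite subr_ge0 tent_cdf_nondecreasing// nodeS lerDl ltW.
Qed.

Lemma short_mass_bounds k s : 0 <= short_mass k s <= period_mass k s.
Proof.
case/andP: r01 => r0 r1.
rewrite subr_ge0 lerD2r !tent_cdf_nondecreasing//.
- by rewrite lerD2r (ler_wpM2r (ltW h0))// -natr1 lerD2l ltW.
- by rewrite lerD2r (ler_wpM2r (ltW h0))// lerDl ltW.
Qed.

(** The sum telescopes, and a shift of at most 1/2 keeps the tent inside [0, 1]. *)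
Lemma sum_period_mass s : 0 <= s <= 2^-1 -> \sum_(k < N) period_mass k s = 1.
Proof.
move=> /andP[s0 s1]; rewrite -(big_mkord xpredT (fun k => period_mass k s)).
rewrite telescope_sumr// divff ?pnatr_eq0// mul0r sub0r.
by rewrite tent_cdfP ?tent_cdfN ?subr0//; lra.
Qed.

(** The part with weight [1 - c] is nonnegative in both cells and is dropped. The remainder keeps
    the mobility at least proportional to [c] during redistribution. *)
Lemma mixed_mass_bounds c k s : 0 <= c <= 1 ->
  c * (alpha * period_mass k s) <= mixed_mass c k s /\
  c * ((1 - alpha) * period_mass k s) <= period_mass k s - mixed_mass c k s.
Proof.
move=> /andP[c0 c1]; have /andP[p0 pM] := short_mass_bounds k s.
have c1' : 0 <= 1 - c by lra.
have ? := mulr_ge0 c1' p0; have ? := ler_wpM2l c1' pM.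
by rewrite /mixed_mass; split; lra.
Qed.

Lemma mixed_state_prob c s : 0 <= c <= 1 -> 0 <= s <= 2^-1 ->
  is_prob (mixed_state c s).
Proof.
move=> c01 s01; case/andP: (c01) => c0 _; case/andP: a01 => a0 a1; split.
  move=> [k b]; rewrite /mixed_state/=; have M0 := period_mass_ge0 k s.
  have [H1 H2] := mixed_mass_bounds k s c01.
  case: b; [apply: le_trans H2|apply: le_trans H1]; rewrite mulr_ge0// mulr_ge0//; lra.
rewrite -(sum_period_mass s01).
transitivity (\sum_(k < N) \sum_(b : bool) mixed_state c s (k, b)).
  by rewrite pair_bigA/=; apply: eq_bigr => -[].
by apply: eq_bigr => k _; rewrite big_bool /mixed_state/= subrK.
Qed.

Lemma mesh_proj_shifted_tent s :
  mesh_proj (periodic_mesh r N) (shifted_tent s) = mixed_state 0 s.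
Proof.
apply/funext => -[k b]; rewrite /mesh_proj.
have lr := cell_left_lt_right r01 (ltn0Sn n) (k, b).
have -> : fine (shifted_tent s (cell ((k, b) : periodic_mesh r N))) =
    tent_cdf (cell_right r (k, b) - s) - tent_cdf (cell_left r (k, b) - s).
  by rewrite /cell/= /periodic_cell; case: ifP => _;
    exact: (congr1 fine (shifted_tent_itv s _ _ lr)).
rewrite /mixed_state /mixed_mass /= subr0 mul1r mul0r addr0.
case: b {lr} => //=; rewrite /period_mass /short_mass /cell_left /cell_right/=.
by rewrite opprB addrA subrK.
Qed.

(** The flux of the moving tent through a node is the speed times [tent]. The two bounds of the mass
    lemmas combine with 80 = 64 + 16. Node [k.+1] ends one period and starts the next, so the
    smaller of both masses is available. *)
Lemma tent_period_mass k s :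
  (tent (k%:R / N%:R - s) * h) ^+ 2 <=
    period_mass k s * (period_mass k s + 80 * h ^+ 2) /\
  (tent (k.+1%:R / N%:R - s) * h) ^+ 2 <=
    Num.min (period_mass k s) (period_mass k.+1 s) *
      (period_mass k s + 80 * h ^+ 2) /\
  (tent (k.+1%:R / N%:R - s) * h) ^+ 2 <=
    period_mass k s * (period_mass k s + 80 * h ^+ 2).
Proof.
have step (x d M M' : R) : 0 < x -> 0 <= M -> d ^+ 2 * x <= M * (d + 64 * x) ->
    d * x <= M' + 16 * x ^+ 2 -> (d * x) ^+ 2 <= M * (M' + 80 * x ^+ 2).
  move=> x0 M0 H1 H2; have := ler_wpM2r (ltW x0) H1 => H3.
  have := ler_wpM2l M0 H2 => H4; rewrite exprMn; lra.
have [L1 L2] := tent_mass_left (k%:R / N%:R - s) h0.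
have [L3 L4] := tent_mass_left (k.+1%:R / N%:R - s) h0.
have [R1 R2] := tent_mass_right (k%:R / N%:R - s) h0.
rewrite -!nodeS in L1 L2 L3 L4 R1 R2.
have M0 := period_mass_ge0 k s; have M1 := period_mass_ge0 k.+1 s.
split; first exact: step.
split; last exact: step.
by case: (leP (period_mass k s) (period_mass k.+1 s)) => _; exact: step.
Qed.

End cell_masses.

(** * Dual action during redistribution and during translation *)

Section phase_bounds.
Context {R : realType}.
Variables (theta : R -> R -> R) (r alpha : R) (n : nat).
Hypotheses (theta_mean : admissible_mean theta) (theta_sym : symmetric_mean theta).
Hypotheses (r01 : 0 < r < 1) (a01 : 0 < alpha < 1).
Local Notation N := n.+1.
Local Notation h := (N%:R^-1 : R).
Local Notation Theta := (theta (alpha / r) ((1 - alpha) / (1 - r))).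
Local Notation M := (@period_mass R n).
Local Notation T := (periodic_mesh r N).

Let N0 : 0 < N%:R :> R. Proof. by rewrite ltr0n. Qed.

Lemma density_short (m : T -> R) (k : 'I_N) :
  m (k, false) / vol ((k, false) : T) = m (k, false) * N%:R / r.
Proof. by rewrite vol_periodic_mesh// invf_div mulrA. Qed.

Lemma density_long (m : T -> R) (k : 'I_N) :
  m (k, true) / vol ((k, true) : T) = m (k, true) * N%:R / (1 - r).
Proof. by rewrite vol_periodic_mesh// invf_div mulrA. Qed.

(* Along [c = (t / tau) ^ 2] the speed [dc] vanishes with [c] fast enough to
   compensate the possible degeneracy of [theta] at the boundary of the
   quadrant. *)
Lemma dual_action_redistribution (tau c dc s : R) (sigma : T -> R) :
  0 < tau -> 0 <= c <= 1 -> dc ^+ 2 = 4 / tau ^+ 2 * c -> 0 <= s <= 2^-1 ->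
  (forall k : 'I_N, sigma (k, false) =
     dc * (alpha * M k s - short_mass r n k s)) ->
  (forall k : 'I_N, sigma (k, true) =
     - (dc * (alpha * M k s - short_mass r n k s))) ->
  (dual_action (fun _ _ => theta) (@mixed_state R r alpha n c s) sigma <=
    (2 / (tau ^+ 2 * Num.min alpha (1 - alpha)) * h ^+ 2)%:E)%E.
Proof.
move=> tau0 c01 dcE s01 sf st.
set g := Num.min alpha (1 - alpha).
have g0 : 0 < g by rewrite lt_min; case/andP: a01 => *; apply/andP; split; lra.
have [m0 _] := mixed_state_prob n r01 a01 c01 s01.
pose I k := - (dc * (alpha * M k s - short_mass r n k s)).
(* Proportional to the period mass, so that the sum over periods is the constant factor; [h ^+ 2]
   offsets one [N] from the link weight and one from the density. *)
pose BI k := 2 / (tau ^+ 2 * g) * h ^+ 2 * M k s.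
apply: (le_trans (dual_action_le_flux theta_mean theta_sym r01 m0
  (density_short _) (density_long _)
  (a := fun k => mixed_mass r alpha n c k s * N%:R / r)
  (b := fun k => (M k s - mixed_mass r alpha n c k s) * N%:R / (1 - r))
  (I := I) (L := fun=> 0) (BI := BI) (BL := fun=> 0) _ _ _ _ _ _)) => //.
- by move=> k; rewrite sf /I sub0r opprK.
- by move=> k; rewrite st /I subr0.
- move=> k _; split.
    by rewrite mulr_ge0 ?period_mass_ge0// mulr_ge0 ?sqr_ge0// divr_ge0//
      mulr_ge0 ?sqr_ge0// ltW.
  have M0 := period_mass_ge0 n k s.
  have [H1 H2] := mixed_mass_bounds alpha n r01 k s c01.
  have /andP[p0 pM] := short_mass_bounds n r01 k s.
  case/andP: (c01) (r01) (a01) => c0 _ /andP[r0 r1] /andP[a0 a1].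
  have ga : g <= alpha by rewrite ge_min lexx.
  have ga' : g <= 1 - alpha by rewrite ge_min lexx orbT.
  (* A common lower bound of the two densities, since [r] and [1 - r] are below 1; hence of their
     mean. *)
  pose x := c * (g * M k s) * N%:R.
  have x0 : 0 <= x by rewrite mulr_ge0 ?ler0n// mulr_ge0// mulr_ge0// ltW.
  have xle (y e : R) : 0 < e < 1 -> c * (g * M k s) <= y -> x <= y * N%:R / e.
    move=> /andP[e0 e1] Hy; rewrite ler_pdivlMr//; apply: le_trans (_ : x <= _).
      by rewrite ler_piMr// ltW.
    by rewrite ler_wpM2r// ltW.
  have Hth : x <= theta (mixed_mass r alpha n c k s * N%:R / r)
      ((M k s - mixed_mass r alpha n c k s) * N%:R / (1 - r)).
    apply: mean_ge_min => //; apply: xle.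
    - by rewrite r0.
    - by apply: le_trans H1; rewrite ler_wpM2l// ler_wpM2r.
    - by apply/andP; split; lra.
    - by apply: le_trans H2; rewrite ler_wpM2l// ler_wpM2r.
  have B0 : 0 <= BI k * (2 * N%:R).
    by rewrite !mulr_ge0 ?sqr_ge0 ?ler0n// invr_ge0 mulr_ge0 ?sqr_ge0// ltW.
  rewrite mulrA; apply: le_trans (ler_wpM2l B0 Hth).
  have -> : BI k * (2 * N%:R) * x = 4 / tau ^+ 2 * c * M k s ^+ 2.
    rewrite /BI /x; field.
    by rewrite !lt0r_neq0.
  rewrite -dcE /I sqrrN exprMn ler_wpM2l ?sqr_ge0//.
  rewrite -(real_normK (num_real (_ - _))) ler_sqr ?nnegrE//.
  have ? := mulr_ge0 (ltW a0) M0.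
  have ? : alpha * M k s <= 1 * M k s by rewrite ler_wpM2r// ltW.
  by rewrite ler_norml; apply/andP; split; lra.
- by move=> k _; rewrite mul0r expr0n/=; split.
rewrite [X in _ + X]big1// addr0 -mulr_sumr sum_period_mass// mulr1.
by [].
Qed.

(** The densities dominate [z * N] times those defining [Theta]; scaling and monotonicity of the
    mean conclude. *)
Lemma mean_oscillating_ge (x y z : R) : 0 <= z -> z <= x -> z <= y ->
  z * N%:R * Theta <= theta (alpha * x * N%:R / r) ((1 - alpha) * y * N%:R / (1 - r)).
Proof.
case/andP: r01 a01 => r0 r1 /andP[a0 a1] z0 zx zy.
have al0 : 0 <= alpha / r by rewrite divr_ge0// ltW.
have be0 : 0 <= (1 - alpha) / (1 - r) by rewrite divr_ge0//; lra.
have zN : 0 <= z * N%:R by rewrite mulr_ge0// ltW.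
apply: (le_trans (mean_scale theta_mean zN al0 be0)); apply: (mean_mono theta_mean).
  rewrite mulr_ge0//= [leRHS](_ : _ = x * N%:R * (alpha / r)); last by field; lra.
  by rewrite ler_wpM2r// ler_wpM2r// ltW.
rewrite mulr_ge0//= [leRHS](_ : _ = y * N%:R * ((1 - alpha) / (1 - r))); last first.
  by field; lra.
by rewrite ler_wpM2r// ler_wpM2r// ltW.
Qed.

Lemma dual_action_translation (v s : R) (sigma : T -> R) :
  0 < Theta -> 0 <= s <= 2^-1 ->
  (forall k : 'I_N, sigma (k, false) =
     alpha * (v * (tent (k%:R / N%:R - s) - tent (k.+1%:R / N%:R - s)))) ->
  (forall k : 'I_N, sigma (k, true) =
     (1 - alpha) * (v * (tent (k%:R / N%:R - s) - tent (k.+1%:R / N%:R - s)))) ->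
  (dual_action (fun _ _ => theta) (@mixed_state R r alpha n 1 s) sigma <=
    (v ^+ 2 / Theta * (1 + 80 * h))%:E)%E.
Proof.
move=> Th0 s01 sf st.
have c01 : 0 <= (1 : R) <= 1 by rewrite ler01 lexx.
have [m0 _] := mixed_state_prob n r01 a01 c01 s01.
have mm k : mixed_mass r alpha n 1 k s = alpha * M k s.
  by rewrite /mixed_mass subrr mul0r add0r mul1r.
have mm' k : M k s - mixed_mass r alpha n 1 k s = (1 - alpha) * M k s.
  by rewrite mm mulrBl mul1r.
pose phi k := tent (k%:R / N%:R - s).
pose L k := v * phi k.
(* The inner flux for which the short cell receives the fraction [alpha] of the net inflow
   [L k - L k.+1]. *)
pose I k := (1 - alpha) * L k + alpha * L k.+1.
(* Each period has an inner and an outer link, each charged half of [v ^+ 2 / Theta]. *)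
pose B k := v ^+ 2 / (2 * Theta) * (M k s + 80 * h ^+ 2).
have M0 k : 0 <= M k s := period_mass_ge0 n k s.
have B0 k : 0 <= B k.
  apply: mulr_ge0; last by rewrite addr_ge0// mulr_ge0// sqr_ge0.
  by rewrite divr_ge0 ?sqr_ge0// mulr_ge0// ltW.
have hN : h * N%:R = 1 by rewrite mulVf// lt0r_neq0.
have key (z d t : R) k : 0 <= z -> (d * h) ^+ 2 <= z * (M k s + 80 * h ^+ 2) ->
    z * N%:R * Theta <= t -> (v * d) ^+ 2 <= B k * (2 * N%:R * t).
  move=> z0 Hz Ht.
  have BN : 0 <= B k * (2 * N%:R) by rewrite mulr_ge0// mulr_ge0// ltW.
  rewrite mulrA; apply: le_trans (ler_wpM2l BN Ht).
  have -> : B k * (2 * N%:R) * (z * N%:R * Theta) =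
      v ^+ 2 * (z * (M k s + 80 * h ^+ 2) * N%:R ^+ 2).
    by rewrite /B; field; rewrite !lt0r_neq0.
  rewrite exprMn ler_wpM2l ?sqr_ge0//.
  have -> : d ^+ 2 = (d * h) ^+ 2 * N%:R ^+ 2 by rewrite -exprMn -mulrA hN mulr1.
  by rewrite ler_wpM2r ?sqr_ge0.
have [r0 r1] := andP r01; have [a0 a1] := andP a01.
have dens0 (x e : R) : 0 <= x -> 0 < e -> 0 <= x * N%:R / e.
  by move=> x0 e0; rewrite divr_ge0 ?(ltW e0)// mulr_ge0.
apply: (le_trans (dual_action_le_flux theta_mean theta_sym r01 m0
  (density_short _) (density_long _)
  (a := fun k => mixed_mass r alpha n 1 k s * N%:R / r)
  (b := fun k => (M k s - mixed_mass r alpha n 1 k s) * N%:R / (1 - r))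
  (I := I) (L := L) (BI := B) (BL := B) _ _ _ _ _ _)) => //.
- rewrite /L /phi tentN ?mulr0// mul0r sub0r oppr_le0; by case/andP: s01.
- rewrite /L /phi tentP ?mulr0// divff ?lt0r_neq0//; case/andP: s01 => *; lra.
- by move=> k; rewrite sf /I /L /phi; ring.
- by move=> k; rewrite st /I /L /phi; ring.
- move=> k _; split=> //; rewrite mm' mm.
  have [P1 [_ P2]] := tent_period_mass n k s.
  have Ht := mean_oscillating_ge (M0 k) (lexx (M k s)) (lexx (M k s)).
  have K1 := key _ _ _ _ (M0 k) P1 Ht; have K2 := key _ _ _ _ (M0 k) P2 Ht.
  (* Convexity of the square reduces the inner flux to the fluxes at the two nodes. *)
  apply: le_trans (_ : (1 - alpha) * L k ^+ 2 + alpha * L k.+1 ^+ 2 <= _).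
    have : 0 <= alpha * (1 - alpha) * (L k - L k.+1) ^+ 2.
      by rewrite mulr_ge0 ?sqr_ge0// mulr_ge0 ?subr_ge0// ltW.
    by rewrite /I => ?; lra.
  have a1' : 0 <= 1 - alpha by lra.
  have := ler_wpM2l a1' K1; have := ler_wpM2l (ltW a0) K2; rewrite /L /phi; lra.
- move=> k _; split=> //; rewrite mm' mm.
  have [_ [P _]] := tent_period_mass n k s.
  have z0 : 0 <= Num.min (M k s) (M k.+1 s) by rewrite le_min !M0.
  (* The outer link sees the long cell first; symmetry restores the order of the arguments in
     [Theta], so it has the same gain as the inner link. *)
  apply: (key _ _ _ _ z0 P); rewrite [leRHS]theta_sym; last 2 first.
  - by apply: dens0; rewrite ?subr_gt0// mulr_ge0// subr_ge0 ltW.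
  - by apply: dens0; rewrite // mulr_ge0// ltW.
  by apply: mean_oscillating_ge => //; rewrite ge_min lexx ?orbT.
have SB : \sum_(k < N) B k = v ^+ 2 / (2 * Theta) * (1 + 80 * h).
  rewrite -mulr_sumr big_split/= sum_period_mass// sumr_const card_ord.
  congr (_ * (1 + _)); rewrite -mulr_natr; field; exact: lt0r_neq0.
have SB' : \sum_(k < n) B k <= \sum_(k < N) B k.
  by rewrite big_ord_recr/= lerDl.
rewrite lee_fin; apply: (le_trans (lerD (lexx _) SB')); rewrite SB.
have -> : v ^+ 2 / Theta * (1 + 80 * h) = v ^+ 2 / (2 * Theta) * (1 + 80 * h) +
   v ^+ 2 / (2 * Theta) * (1 + 80 * h) by field; rewrite !lt0r_neq0.
by [].
Qed.

End phase_bounds.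

(** Within a phase the curve has a simpler formula [g], and the derivative only sees nearby
    times. *)
Lemma derive1_local_taylor (R : realType) (f g : R -> R) (a b t l C : R) :
  a < t < b -> (forall y, a < y < b -> f y = g y) ->
  (forall y, `|g y - g t - l * (y - t)| <= C * (y - t) ^+ 2) ->
  derive1 f t = l.
Proof.
move=> tab fg /is_derive_taylor gl.
have gf : \near t, g t = f t.
  have /near_in_itvoo : t \in `]a, b[ by rewrite in_itv.
  by apply: filterS => y; rewrite in_itv/= => yab; rewrite fg.
by rewrite derive1E; have fl := near_eq_is_derive gf gl; rewrite derive_val.
Qed.

(** * The competitor curve and its cost *)

Section curve.
Context {R : realType}.
Variables (theta : R -> R -> R) (r alpha tau : R) (n : nat).
Hypotheses (theta_mean : admissible_mean theta) (theta_sym : symmetric_mean theta).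
Hypotheses (r01 : 0 < r < 1) (a01 : 0 < alpha < 1) (tau01 : 0 < tau < 2^-1).
Local Notation N := n.+1.
Local Notation h := (N%:R^-1 : R).
Local Notation Theta := (theta (alpha / r) ((1 - alpha) / (1 - r))).
Hypothesis Theta0 : 0 < Theta.
Local Notation M := (@period_mass R n).
Local Notation p := (@short_mass R r n).
Local Notation T := (periodic_mesh r N).
Local Notation v := ((2 * (1 - 2 * tau))^-1 : R).

(** One clamped formula for all three phases, so that Lipschitz continuity follows from closure
    rules without gluing. *)
Definition mixing (t : R) : R := Num.min 1 (Num.min (t / tau) ((1 - t) / tau)) ^+ 2.

Definition position (t : R) : R :=
  Num.min 1 (pospart ((t - tau) / (1 - 2 * tau))) / 2.

Definition recovery_curve (t : R) : T -> R :=
  @mixed_state R r alpha n (mixing t) (position t).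

Let tau0 : 0 < tau. Proof. by case/andP: tau01. Qed.
Let tau1 : 0 < 1 - 2 * tau. Proof. by case/andP: tau01 => *; lra. Qed.

Lemma mixing01 t : 0 <= t <= 1 -> 0 <= mixing t <= 1.
Proof.
move=> /andP[t0 t1]; rewrite /mixing; set x := Num.min _ _.
have x0 : 0 <= x by rewrite !le_min ler01 !divr_ge0 ?subr_ge0// ltW.
have x1 : x <= 1 by rewrite ge_min lexx.
by rewrite sqr_ge0 expr_le1.
Qed.

Lemma position01 t : 0 <= position t <= 2^-1.
Proof.
rewrite /position; set x := Num.min _ _.
have x0 : 0 <= x by rewrite le_min ler01/= /pospart le_max lexx.
have x1 : x <= 1 by rewrite ge_min lexx.
by apply/andP; split; lra.
Qed.

Lemma mixing_first t : t <= tau -> mixing t = (t / tau) ^+ 2.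
Proof.
move=> tt; congr (_ ^+ 2); have t1 : t / tau <= 1 by rewrite ler_pdivrMr// mul1r.
have t2 : t / tau <= (1 - t) / tau
  by rewrite ler_wpM2r ?invr_ge0 ?(ltW tau0)//; have := tau1; lra.
by rewrite (min_l t2) min_r.
Qed.

Lemma mixing_last t : 1 - tau <= t -> mixing t = ((1 - t) / tau) ^+ 2.
Proof.
move=> tt; congr (_ ^+ 2).
have t1 : (1 - t) / tau <= 1 by rewrite ler_pdivrMr// mul1r; lra.
have t2 : (1 - t) / tau <= t / tau
  by rewrite ler_wpM2r ?invr_ge0 ?(ltW tau0)//; have := tau1; lra.
by rewrite (min_r t2) min_r.
Qed.

Lemma mixing_middle t : tau <= t <= 1 - tau -> mixing t = 1.
Proof.
move=> /andP[? ?]; rewrite /mixing min_l ?expr1n// le_min !ler_pdivlMr//.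
by apply/andP; split; lra.
Qed.

Lemma position_first t : t <= tau -> position t = 0.
Proof.
move=> tt; rewrite /position /pospart max_l ?min_r ?mul0r//.
by rewrite ler_pdivrMr// mul0r subr_le0.
Qed.

Lemma position_last t : 1 - tau <= t -> position t = 2^-1.
Proof.
move=> tt; rewrite /position min_l ?mul1r// /pospart le_max; apply/orP; right.
by rewrite ler_pdivlMr//; lra.
Qed.

Lemma position_middle t : tau <= t <= 1 - tau -> position t = v * (t - tau).
Proof.
move=> /andP[? ?]; rewrite /position /pospart max_r; last first.
  by rewrite divr_ge0 ?(ltW tau1)//; lra.
rewrite min_r; last by rewrite ler_pdivrMr//; lra.
by field; apply: lt0r_neq0.
Qed.

Lemma lip01_mixing : lip01 mixing.
Proof.
rewrite /mixing; under eq_fun do rewrite expr2.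
have L : lip01 (fun t => Num.min 1 (Num.min (t / tau) ((1 - t) / tau))).
  apply: lip01_min; first exact: lip01_cst.
  by apply: lip01_min; apply: lip01M => //; [exact: lip01_id|exact: lip01_cst|
    apply: lip01D; [exact: lip01_cst|apply/lip01N/lip01_id]|exact: lip01_cst].
exact: lip01M.
Qed.

Lemma lip01_position : lip01 position.
Proof.
apply: lip01M; last exact: lip01_cst.
apply: lip01_min; first exact: lip01_cst.
apply: (@lip01_comp _ (@pospart R) (fun t => (t - tau) / (1 - 2 * tau)) 1 ler01).
  move=> x y; rewrite mul1r /pospart.
  by rewrite !ler_norml; case: (leP 0 x) => ?; case: (leP 0 y) => ?;
    have := ler_norm (x - y); have := ler_norm (y - x);
    rewrite (distrC y) => *; apply/andP; split; lra.
apply: lip01M; last exact: lip01_cst.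
by apply: lip01D; [exact: lip01_id|exact: lip01_cst].
Qed.

Lemma lip01_tent_cdf_position x : lip01 (fun t => tent_cdf (x - position t)).
Proof.
apply: (@lip01_comp _ tent_cdf _ 20) => //.
  by move=> a b; exact: tent_cdf_lipschitz.
by apply: lip01D; [exact: lip01_cst|apply/lip01N/lip01_position].
Qed.

Lemma recovery_curve_is_curve :
  is_curve (mesh_proj T (shifted_tent 0)) (mesh_proj T (shifted_tent 2^-1))
    recovery_curve.
Proof.
split.
- by move=> t t01; apply: mixed_state_prob => //; [exact: mixing01|exact: position01].
- move=> [k b]; apply: lip01_abs_continuous.
  have LM : lip01 (fun t => M k (position t)).
    by apply: lip01D; [|apply: lip01N]; exact: lip01_tent_cdf_position.
  have Lp : lip01 (fun t => p k (position t)).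
    by apply: lip01D; [|apply: lip01N]; exact: lip01_tent_cdf_position.
  have Lm : lip01 (fun t => mixed_mass r alpha n (mixing t) k (position t)).
    apply: lip01D; apply: lip01M.
    - by apply: lip01D; [exact: lip01_cst|apply/lip01N/lip01_mixing].
    - exact: Lp.
    - exact: lip01_mixing.
    - by apply: lip01M; [exact: lip01_cst|exact: LM].
  case: b; rewrite /recovery_curve /mixed_state/=; last exact: Lm.
  by apply: lip01D; [|apply: lip01N].
- rewrite (@mesh_proj_shifted_tent _ r alpha n r01) /recovery_curve.
  by rewrite mixing_first ?position_first ?(ltW tau0)// mul0r expr0n.
- rewrite (@mesh_proj_shifted_tent _ r alpha n r01) /recovery_curve.
  by rewrite mixing_last ?position_last ?subrr ?mul0r ?expr0n//; have := tau0; lra.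
Qed.

(** The masses are affine in the mixing parameter, and [q] is a quadratic with leading coefficient
    [1 / tau ^+ 2], so the Taylor remainder is exact. *)
Lemma derive_redistribution (q : R -> R) (a b t dq s : R) (k : 'I_N) (e : bool) :
  a < t < b ->
  (forall y, a < y < b -> mixing y = q y /\ position y = s) ->
  (forall y, q y - q t - dq * (y - t) = (y - t) ^+ 2 / tau ^+ 2) ->
  derive1 (recovery_curve ^~ (k, e)) t =
    (if e then -1 else 1) * (dq * (alpha * M k s - p k s)).
Proof.
move=> tab qs qE; pose g y := mixed_mass r alpha n (q y) k s.
pose D := alpha * M k s - p k s.
have gE y : g y - g t - dq * D * (y - t) = D / tau ^+ 2 * (y - t) ^+ 2.
  rewrite /g /mixed_mass /D; transitivity ((q y - q t - dq * (y - t)) * D).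
    by rewrite /D; ring.
  by rewrite qE /D; field; exact: lt0r_neq0.
have gN y : `|g y - g t - dq * D * (y - t)| <= `|D / tau ^+ 2| * (y - t) ^+ 2.
  by rewrite gE normrM ler_wpM2l// ger0_norm// sqr_ge0.
case: e.
  apply: (@derive1_local_taylor _ _ (fun y => M k s - g y) a b t _ `|D / tau ^+ 2|) => //.
    by move=> y /qs[qy sy]; rewrite /recovery_curve /mixed_state /= qy sy.
  move=> y; rewrite -normrN; apply: le_trans (gN y).
  by rewrite le_eqVlt; apply/orP; left; apply/eqP; congr (`| _ |); rewrite /D; ring.
rewrite mul1r; apply: (@derive1_local_taylor _ _ g a b t _ `|D / tau ^+ 2|) => //.
by move=> y /qs[qy sy]; rewrite /recovery_curve /mixed_state /= qy sy.
Qed.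

Lemma derive_translation (t : R) (k : 'I_N) (e : bool) : tau < t < 1 - tau ->
  derive1 (recovery_curve ^~ (k, e)) t =
    (if e then 1 - alpha else alpha) *
    (v * (tent (k%:R / N%:R - position t) - tent (k.+1%:R / N%:R - position t))).
Proof.
move=> tt; have tt' : tau <= t <= 1 - tau by case/andP: tt => /ltW -> /ltW ->.
pose x := k%:R / N%:R : R; pose x' := k.+1%:R / N%:R : R.
pose g (y : R) := tent_cdf (x' - v * (y - tau)) - tent_cdf (x - v * (y - tau)).
have gE (c : R) y : 0 <= c <= 1 ->
  `|c * g y - c * g t -
    c * (v * (tent (x - position t) - tent (x' - position t))) * (y - t)|
    <= 32 * v ^+ 2 * (y - t) ^+ 2.
  move=> /andP[c0 c1]; rewrite position_middle// /g.
  have := tent_cdf_taylor (x - v * (t - tau)) (x - v * (y - tau)).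
  have := tent_cdf_taylor (x' - v * (t - tau)) (x' - v * (y - tau)).
  have dE z : z - v * (y - tau) - (z - v * (t - tau)) = - (v * (y - t)) by ring.
  rewrite !dE sqrrN exprMn.
  set A := _ - _ - _; set A' := _ - _ - _ => HA HA'.
  rewrite (_ : _ - _ = c * (A - A')); last by rewrite /A /A'; ring.
  rewrite normrM (ger0_norm c0).
  have := ler_normB A A'; have := normr_ge0 (A - A') => d0 dA.
  have := ler_wpM2r d0 c1; rewrite mul1r; lra.
have curveE y : tau < y < 1 - tau -> recovery_curve y (k, e) =
    (if e then 1 - alpha else alpha) * g y.
  move=> yy; have yy' : tau <= y <= 1 - tau by case/andP: yy => /ltW -> /ltW ->.
  rewrite /recovery_curve mixing_middle// position_middle//.
  rewrite /mixed_state /mixed_mass /= subrr mul0r add0r mul1r.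
  by case: (e); rewrite // mulrBl mul1r.
apply: (@derive1_local_taylor _ _ (fun y => (if e then 1 - alpha else alpha) * g y)
  tau (1 - tau) t _ (32 * v ^+ 2)) => // y.
by apply: gE; case/andP: a01 => *; case: (e); apply/andP; split; lra.
Qed.

Let g := Num.min alpha (1 - alpha).
Let E1 := 2 / (tau ^+ 2 * g) * h ^+ 2.
Let E2 := v ^+ 2 / Theta * (1 + 80 * h).

Let speed t : \bar R := dual_action (fun _ _ => theta) (recovery_curve t)
  (fun K => derive1 (recovery_curve ^~ K) t).

Lemma dual_action_ge0 (S : mesh R) (m sigma : S -> R) :
  (0 <= dual_action (fun _ _ => theta) m sigma)%E.
Proof.
apply: ereal_sup_ubound; exists (fun=> 0) => //; congr (_%:E).
rewrite big1 ?mulr0; last by move=> K _; rewrite mul0r.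
rewrite /action big1 ?mulr0 ?subr0// => K _.
by rewrite big1// => L _; rewrite expr0n mulr0.
Qed.

Let speed_first t : 0 < t < tau -> (speed t <= E1%:E)%E.
Proof.
move=> tt; have [t0 t1] := andP tt.
have HD k e := @derive_redistribution (fun u => (u / tau) ^+ 2) 0 tau t
  (2 * t / tau ^+ 2) 0 k e tt.
have {}HD k e : derive1 (recovery_curve ^~ (k, e)) t =
    (if e then -1 else 1) * (2 * t / tau ^+ 2 * (alpha * M k 0 - p k 0)).
  apply: HD => y; last by field; exact: lt0r_neq0.
  by move=> /andP[_ /ltW yt]; rewrite mixing_first// position_first.
rewrite /speed {1}/recovery_curve mixing_first ?position_first ?(ltW t1)//.
apply: (dual_action_redistribution theta_mean theta_sym r01 a01 tau0
   (dc := 2 * t / tau ^+ 2)).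
- by rewrite sqr_ge0 expr_le1// ?divr_ge0 ?ler_pdivrMr ?mul1r ?ltW.
- by field; exact: lt0r_neq0.
- by apply/andP; split; lra.
- by move=> k; rewrite HD mul1r.
- by move=> k; rewrite HD mulN1r.
Qed.

Let speed_last t : 1 - tau < t < 1 -> (speed t <= E1%:E)%E.
Proof.
move=> tt; have [t0 t1] := andP tt.
have HD k e := @derive_redistribution (fun u => ((1 - u) / tau) ^+ 2) (1 - tau) 1 t
  (- (2 * (1 - t) / tau ^+ 2)) 2^-1 k e tt.
have {}HD k e : derive1 (recovery_curve ^~ (k, e)) t =
    (if e then -1 else 1) *
    (- (2 * (1 - t) / tau ^+ 2) * (alpha * M k 2^-1 - p k 2^-1)).
  apply: HD => y; last by field; exact: lt0r_neq0.
  by move=> /andP[/ltW yt _]; rewrite mixing_last// position_last.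
rewrite /speed {1}/recovery_curve mixing_last ?position_last ?(ltW t0)//.
apply: (dual_action_redistribution theta_mean theta_sym r01 a01 tau0
   (dc := - (2 * (1 - t) / tau ^+ 2))).
- rewrite sqr_ge0 expr_le1//; first by rewrite ler_pdivrMr// mul1r; lra.
  by rewrite divr_ge0// ?ltW//; lra.
- by field; exact: lt0r_neq0.
- by apply/andP; split; lra.
- by move=> k; rewrite HD mul1r.
- by move=> k; rewrite HD mulN1r.
Qed.

Let speed_middle t : tau < t < 1 - tau -> (speed t <= E2%:E)%E.
Proof.
move=> tt; have tt' : tau <= t <= 1 - tau by case/andP: tt => /ltW -> /ltW ->.
rewrite /speed {1}/recovery_curve mixing_middle//.
apply: (dual_action_translation theta_mean theta_sym r01 a01 Theta0 (position01 t)).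
- by move=> k; rewrite derive_translation.
- by move=> k; rewrite derive_translation.
Qed.

Lemma transport_metric_le :
  (transport_metric (fun _ _ : T => theta)
    (mesh_proj T (shifted_tent 0)) (mesh_proj T (shifted_tent 2^-1)) <=
   (Num.sqrt (2 / (tau ^+ 2 * g) * h ^+ 2 +
      (1 + 80 * h) / (4 * ((1 - 2 * tau) * Theta))))%:E)%E.
Proof.
have g0 : 0 < g by rewrite lt_min; case/andP: a01 => *; apply/andP; split; lra.
have E10 : 0 <= E1.
  by rewrite mulr_ge0 ?sqr_ge0// divr_ge0// mulr_ge0 ?sqr_ge0// ltW.
have E20 : 0 <= E2.
  by rewrite mulr_ge0// divr_ge0 ?sqr_ge0// ltW.
apply: le_trans.
  apply: ereal_inf_lbound; exists recovery_curve; last by [].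
  exact: recovery_curve_is_curve.
(* The speed [v] travels 1/2 in time [1 - 2 * tau]. [E1] is charged at all times, [E2] only during
   translation. *)
have -> : (1 + 80 * h) / (4 * ((1 - 2 * tau) * Theta)) = E2 * (1 - tau - tau).
  rewrite /E2; field.
  by rewrite !lt0r_neq0//; have := tau1; lra.
rewrite -[X in (_ <= X)%E]/(sqrte (_)%:E) lee_sqrt; last first.
  by rewrite lee_fin addr_ge0// mulr_ge0//; have := tau1; lra.
(* The exceptional times are the ends of the phases. *)
apply: (@integral_le_step _ _ _ _ _ _ [set 0; tau; 1 - tau; 1]) => //.
- by apply/andP; split; [exact: ltW|have := tau1; lra].
- by have := tau0; lra.
- by move=> t _; exact: dual_action_ge0.
move=> t /andP[t0 t1] /= Nt; rewrite indicE.
have {}t0 : 0 < t.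
  by rewrite lt_neqAle t0 andbT; apply/eqP => tE; apply: Nt; rewrite -tE; do 3 left.
have {}t1 : t < 1.
  by rewrite lt_neqAle t1 andbT; apply/eqP => tE; apply: Nt; rewrite tE; right.
have [h1|h1|h1] := ltgtP t tau; last by case: Nt; rewrite h1; do 2 left; right.
- rewrite memNset ?mulr0 ?addr0; first by apply: speed_first; rewrite t0.
  by rewrite /= in_itv/= => /andP[]; lra.
- have [h2|h2|h2] := ltgtP t (1 - tau); last by case: Nt; rewrite h2; left; right.
    rewrite mem_set ?mulr1/=; last by rewrite in_itv/= h1.
    have h12 : tau < t < 1 - tau by rewrite h1.
    by apply: (le_trans (speed_middle h12)); rewrite lee_fin lerDr.
  rewrite memNset ?mulr0 ?addr0; first by apply: speed_last; rewrite h2.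
  by rewrite /= in_itv/= => /andP[]; lra.
Qed.

End curve.

(** * Passing to the limit and conclusion *)

Lemma shifted_tent_on_unit_interval (R : realType) (s : R) :
  0 <= s <= 2^-1 -> on_unit_interval (shifted_tent s).
Proof.
move=> /andP[s0 s1]; rewrite /on_unit_interval shifted_tent_itv//.
by rewrite tent_cdfP ?tent_cdfN ?subr0//; lra.
Qed.

Lemma limn_esup_le_near (R : realType) (u : (\bar R)^nat) (l : \bar R) :
  (\forall n \near \oo, (u n <= l)%E) -> (limn_esup u <= l)%E.
Proof.
move=> ul; apply: le_trans.
  by apply: ereal_inf_lbound; eexists; [exact: ul|reflexivity].
by apply: ge_ereal_sup => _ [n un <-].
Qed.

Theorem proposition1p2 (R : realType) (theta : R -> R -> R)
    (theta_mean : admissible_mean theta) (theta_sym : symmetric_mean theta) :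
  exists mu0 mu1 : probability (measurableTypeR R) R,
    [/\ on_unit_interval mu0, on_unit_interval mu1 &
      forall r : R, 0 < r < 2^-1 ->
        (limn_esup (fun N : nat =>
           @transport_metric R (periodic_mesh r N) (fun _ _ => theta)
             (mesh_proj (periodic_mesh r N) mu0)
             (mesh_proj (periodic_mesh r N) mu1))
         < W2 mu0 mu1)%E].
Proof.
exists (shifted_tent 0), (shifted_tent 2^-1); split.
- by apply: shifted_tent_on_unit_interval; rewrite lexx/=; lra.
- by apply: shifted_tent_on_unit_interval; rewrite lexx andbT.
move=> r r2; have r01 : 0 < r < 1 by case/andP: r2 => *; apply/andP; split; lra.
have [alpha [a01 Th]] := mean_oscillation theta_mean theta_sym r2.
set Theta := theta _ _ in Th.
have half0 : 0 <= 2^-1 :> R by rewrite invr_ge0.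
apply: lt_le_trans (W2_shifted_tent half0).
(* [(1 - 2 * tau) * Theta = (1 + Theta) / 2 > 1] *)
pose tau := (1 - Theta^-1) / 4.
have Th0 : 0 < Theta by lra.
have Thi : 0 < Theta^-1 < 1 by rewrite invr_gt0 Th0 invf_lt1.
have tau01 : 0 < tau < 2^-1.
  by case/andP: Thi => *; rewrite /tau; apply/andP; split; lra.
pose D := (4 * ((1 - 2 * tau) * Theta))^-1.
have DE : D = (2 * (1 + Theta))^-1.
  by rewrite /D /tau; congr _^-1; field; exact: lt0r_neq0.
have D4 : D < 4^-1 by rewrite DE ltf_pV2 ?posrE; lra.
have D0 : 0 < D by rewrite DE invr_gt0; lra.
(* [D] is the limiting squared cost and 1/4 the squared bound on [W2]; the midpoint leaves room for
   the errors in [1 / N]. *)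
pose q := (D + 4^-1) / 2.
have q4 : Num.sqrt q < 2^-1.
  rewrite -[ltRHS]ger0_norm// -sqrtr_sqr ltr_sqrt ?exprn_gt0 ?invr_gt0//.
  by rewrite expr2 -invfM /q; lra.
apply: (@le_lt_trans _ _ (Num.sqrt q)%:E); last by rewrite lte_fin.
apply: limn_esup_le_near.
pose A := 2 / (tau ^+ 2 * Num.min alpha (1 - alpha)).
have A0 : 0 <= A.
  rewrite divr_ge0// mulr_ge0 ?sqr_ge0// le_min.
  by case/andP: a01 => *; apply/andP; split; lra.
(* With [x = 1 / N <= 1] and [D <= 1], the error [A * x ^+ 2 + 80 * x * D] is at most
   [(A + 80) * x]. *)
have e0 : 0 < (q - D) / (A + 80) by rewrite divr_gt0 /q; lra.
have large : \forall N \near \oo, ((q - D) / (A + 80))^-1 <= N%:R :> R.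
  exact: nbhs_infty_ger.
move: large (nbhs_infty_gt 0); apply: filterS2 => -[//|n] Nlarge _.
have hn : n.+1%:R^-1 <= (q - D) / (A + 80) by rewrite invf_ple ?posrE ?ltr0n.
apply: (le_trans (transport_metric_le n theta_mean theta_sym r01 a01 tau01 Th0)).
rewrite lee_fin ler_sqrt; last by rewrite /q; lra.
have h0 : 0 < n.+1%:R^-1 :> R by rewrite invr_gt0 ltr0n.
have h1 : n.+1%:R^-1 <= 1 :> R by rewrite invf_le1 ?ltr0n// ler1n.
rewrite -/A -/D; set x := n.+1%:R^-1 in hn h0 h1 *.
have : A * x ^+ 2 <= A * x.
  by rewrite ler_wpM2l// expr2 ler_piMr// ltW.
move: hn; rewrite ler_pdivlMr; last lra.
have : x * D <= x * 1 by rewrite ler_wpM2l ?(ltW h0)//; lra.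
lra.
Qed.
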